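(* Let $2\le d\le 6$. The minimum ML degree of the scaled toric variety $V_d^c$ that can be achieved by choosing a suitable scaling $c\in(\mathbb{C}^* )^{d(d-1)/2}$ is $\binom{d-1}{2}$; that is, $$\min_{c\in(\mathbb{C}^* )^{d(d-1)/2}}\operatorname{MLdeg}(V_d^c)=\binom{d-1}{2}.$$
   Context: A scaling is a vector $c=(c_{ij})_{1\le i<j\le d}\in(\mathbb{C}^* )^{d(d-1)/2}$. Put $n=d(d-1)/2$ and index the homogeneous coordinates of $\mathbb{CP}^{n-1}$ by pairs $1\le i<j\le d$, which correspond to the lattice points $e_i+e_j$ of the second hypersimplex $\Delta_{d,2}=\{x\in[0,1]^d\mid x_1+\dots+x_d=2\}$, where $e_i$ is the $i$-th standard basis vector of $\mathbb{R}^d$. The scaled toric variety $V_d^c\subseteq\mathbb{CP}^{n-1}$ is the Zariski closure of the image of $(\mathbb{C}^* )^d\to\mathbb{CP}^{n-1}$, $(\theta_1,\dots,\theta_d)\mapsto[c_{ij}\theta_i\theta_j]_{1\le i<j\le d}$. ML degree: write the homogeneous coordinates as $p_1,\dots,p_n$, let $\mathcal{H}=\{p\in\mathbb{CP}^{n-1}\mid p_1\cdots p_n(p_1+\dots+p_n)=0\}$, and for $u\in\mathbb{C}^n$ let $L_u(p)=p_1^{u_1}\cdots p_n^{u_n}/(p_1+\dots+p_n)^{u_1+\dots+u_n}$ be the likelihood function. The ML degree $\operatorname{MLdeg}(V)$ of a scaled toric variety $V$ is the number of complex critical points of $L_u$ restricted to $V\setminus\mathcal{H}$ (i.e. points where the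 differential of $\log L_u$ restricted to $V\setminus\mathcal{H}$ vanishes) for generic $u\in\mathbb{C}^n$.
   Formalization: The case d = 2 is excluded (3 ≤ d ≤ 6 is assumed), because there the variety is the single point CP^0, which is critical for every u, so its ML degree is 1 and not binom(1,2) = 0. *)

(* Defs.v *)
From mathcomp Require Import all_boot all_order all_algebra.
From mathcomp Require Import mpoly complex.
From mathcomp Require Import boolp classical_sets functions cardinality reals.

Set Implicit Arguments.
Unset Strict Implicit.
Unset Printing Implicit Defensive.

Import GRing.Theory.
Local Open Scope classical_set_scope.
Local Open Scope ring_scope.

(* Subsets of the projective space CP^(n-1) are given by their sets of nonzero
   homogeneous coordinate vectors in 'rV[C]_n; the point with coordinates p
   is the line <[p]>%VS. *)
Section MaximumLikelihoodDegree.
Variables (C : fieldType) (n : nat).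
Implicit Types (p q u v : 'rV[C]_n) (S V : set 'rV[C]_n).

Definition homog_vanishing S : set {mpoly C[n]} :=
  [set f : {mpoly C[n]} | (exists e, f \is e.-homog) /\ forall p, S p -> f.@[p 0] = 0].

Definition zariski_closure S : set 'rV[C]_n :=
  [set p : 'rV[C]_n | p != 0 /\ forall f, homog_vanishing S f -> f.@[p 0] = 0].

(* Zariski tangent space at p of the affine cone over V; the tangent space of
   V at the projective point p is its quotient by the line through p. *)
Definition cone_tangent V p : set 'rV[C]_n :=
  [set v : 'rV[C]_n | forall f, homog_vanishing V f ->
     \sum_(k < n) (f^`M(k)).@[p 0] * v 0 k = 0].

Definition hyperplanes : set 'rV[C]_n :=
  [set p : 'rV[C]_n | (\prod_(k < n) p 0 k) * (\sum_(k < n) p 0 k) = 0].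

(* The differential at p, in the direction v, of
     log L_u = \sum_k u_k log p_k - (\sum_k u_k) log (\sum_k p_k).
   It vanishes at v = p, so it descends to the tangent space of CP^(n-1). *)
Definition dlog_likelihood u p v : C :=
  \sum_(k < n) u 0 k * v 0 k / p 0 k
  - (\sum_(k < n) u 0 k) * (\sum_(k < n) v 0 k) / (\sum_(k < n) p 0 k).

Definition critical V u : set 'rV[C]_n :=
  [set p : 'rV[C]_n | [/\ V p, ~ hyperplanes p &
     forall v, cone_tangent V p v -> dlog_likelihood u p v = 0]].

Definition critical_points V u : set {vspace 'rV[C]_n} :=
  [set <[p]>%VS | p in critical V u].

(* Generic u: all u off the zero locus of some nonzero polynomial.  The notion
   is meant for V smooth off the hyperplanes, where Zariski tangent spaces are
   the tangent spaces; this holds for scaled toric varieties, whose points with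
   no zero coordinate form a single torus orbit. *)
Definition is_ML_degree V (m : nat) : Prop :=
  exists2 g : {mpoly C[n]}, g != 0 &
    forall u, g.@[u 0] != 0 -> (critical_points V u #= `I_m)%card.

End MaximumLikelihoodDegree.

Definition edge (d : nat) := {ij : 'I_d * 'I_d | (ij.1 < ij.2)%N}.

Definition n_edges (d : nat) : nat := #|{: edge d}|.

Definition edge_of (d : nat) (k : 'I_(n_edges d)) : 'I_d * 'I_d :=
  val (enum_val k).

Lemma n_edgesE d : n_edges d = 'C(d, 2).
Proof.
rewrite /n_edges card_sig -sum1_card big_mkcond /=.
rewrite -(pair_bigA _ (fun i j : 'I_d => if (i < j)%N then 1%N else 0%N)) /=.
rewrite exchange_big /= -bin2_sum big_mkord; apply: eq_bigr => j _.
by rewrite -big_mkcond -(big_ord_widen _ (fun=> 1%N) (ltnW (ltn_ord j))) sum1_card card_ord.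
Qed.

Section SecondHypersimplex.
Variables (C : fieldType) (d : nat).

Definition scaling (c : edge d -> C) : Prop := forall ij, c ij != 0.

Definition torus_image (c : edge d -> C) : set 'rV[C]_(n_edges d) :=
  [set p : 'rV[C]_(n_edges d) | exists2 theta : 'I_d -> C, (forall i, theta i != 0) &
     p = \row_k (c (enum_val k) *
                 theta (edge_of k).1 * theta (edge_of k).2)].

Definition scaled_toric (c : edge d -> C) : set 'rV[C]_(n_edges d) :=
  zariski_closure (torus_image c).

Definition achieved_ML_degrees : set nat :=
  [set m | exists2 c : edge d -> C, scaling c &
     is_ML_degree (scaled_toric c) m].

Definition is_min_ML_degree (m : nat) : Prop :=
  achieved_ML_degrees m /\ forall m', achieved_ML_degrees m' -> (m <= m')%N.

End SecondHypersimplex.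

(* For d = 2 the variety is the whole of CP^0, a single point, which is critical
   for every u: the ML degree is 1, whereas 'C(1, 2) = 0. *)
Lemma critical_points_d2 (C : fieldType) (c : edge 2 -> C)
    (u : 'rV[C]_(n_edges 2)) :
  scaling c -> (critical_points (scaled_toric c) u #= `I_1)%card.
Proof.
move=> c0; have n1 : n_edges 2 = 1%N by rewrite n_edgesE.
pose k0 : 'I_(n_edges 2) := cast_ord (esym n1) ord0.
have kE (k : 'I_(n_edges 2)) : k = k0.
  by apply: val_inj; case: k => -[|k] //=; rewrite n1.
have sumE (F : 'I_(n_edges 2) -> C) : \sum_k F k = F k0.
  by rewrite (bigD1 k0) //= big1 ?addr0 // => k; rewrite (kE k) eqxx.
have prodE (F : 'I_(n_edges 2) -> C) : \prod_k F k = F k0.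
  by rewrite (bigD1 k0) //= big1 ?mulr1 // => k; rewrite (kE k) eqxx.
pose q : 'rV[C]_(n_edges 2) := \row_k (c (enum_val k) * 1 * 1).
have q0 : q 0 k0 != 0 by rewrite mxE !mulr1 c0.
have pE (p : 'rV[C]_(n_edges 2)) : p = (p 0 k0 / q 0 k0) *: q.
  by apply/rowP => k; rewrite (kE k) mxE divfK.
suff -> : critical_points (scaled_toric c) u = [set <[q]>%VS] by exact: card_set1.
apply/seteqP; split=> [_ [p [[p0 _] _ _] <-]|_ ->] /=.
  have [a pa] : exists a, p = a *: q by exists (p 0 k0 / q 0 k0); exact: pE.
  rewrite pa in p0 *; have a0 : a != 0.
    by apply/eqP => a0; move: p0; rewrite a0 scale0r eqxx.
  apply/vspaceP => v; apply/vlineP/vlineP => -[b ->].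
    by exists (b * a); rewrite scalerA.
  by exists (b / a); rewrite scalerA divfK.
exists q => //; split.
- split; first by apply/eqP => qz; move: q0; rewrite qz mxE eqxx.
  by move=> f [_]; apply; exists (fun=> 1) => // i; rewrite oner_eq0.
- by rewrite /hyperplanes /= sumE prodE => /eqP; rewrite mulf_eq0 (negPf q0).
- by move=> v _; rewrite /dlog_likelihood !sumE subrr.
Qed.

(* Main.v *)
Require Import Defs.
From HB Require Import structures.
From mathcomp Require Import all_boot all_order all_algebra all_field.
From mathcomp Require Import mpoly ring zify.
From mathcomp Require Import boolp classical_sets functions cardinality.
From mathcomp Require Import complex reals.

(** Off the coordinate hyperplanes a point of the scaled toric variety is a
    vector [c_ij t_i t_j] with [t] in the torus. Let [Q] be the symmetric matrix
    with zero diagonal and entries [c_ij], and let [w_i] be the sum of the data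
    [u] over the edges at [i]. The point is critical exactly when the numbers
    [t_i * (Q t)_i] are proportional to the [w_i] ([critical_toric_point],
    [critical_moment]). Hence the ML degree counts, up to scaling of [t], the
    solutions of [F t = w] for generic [w], where [F_i = t_i * (Q t)_i]; the map
    [F] is called [moment] below.

    Lower bound, for every scaling. The binomial ['C(d-1, 2)] is the number of
    products [t_i t_j] with [0 < i < j < d], and these products are linearly
    independent over the field [C(F)] ([products_independent]). Indeed, take a
    relation [\sum a_ij(F) t_i t_j = 0] with polynomial coefficients and let [k]
    be the last index. The hypersurface [F_k = 0] has the two components
    [t_k = 0] and [(Q t)_k = 0]. On each of them the relation involves fewer
    variables [F_i], and on the first one also fewer products; if by induction
    every [a_ij] vanishes on [w_k = 0], then all of them are divisible by [w_k],
    and dividing the relation by [F_k] lowers the degree ([relation_descent]).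
    The induction ends at spaces cut out by two equations [(Q t)_l = (Q t)_m = 0].
    Eliminating [t_l] and [t_m] replaces [Q] by a symmetric matrix whose diagonal
    entries [- 2 q_kl q_km / q_lm] are nonzero, and for such a matrix the moment
    map is dominant ([moment_dominant]). The number of solutions is now a field
    degree: [t_0 ^ 2] and the quotients [t_i / t_0] are algebraic over [C(F)]
    ([algebraic_dependence]), so they are polynomials in a primitive element [z].
    The minimal polynomial of [z] is separable and has degree at least
    ['C(d-1, 2)] by independence; for [w] off a hypersurface each of its
    specialized roots yields a solution of [F t = w], and distinct roots yield
    distinct solutions ([generic_solutions]).

    Upper bound, for the scaling [c_ij = (x_i - x_j) ^ 2] with distinct nodes
    [x_i]. Here [(Q t)_i = f(x_i)] for a polynomial [f] of degree two, and the
    equations [F t = w] say that the two roots of [f] are exchanged by the rational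
    function [A / N], where [N = \sum w_i \prod_(j != i) (X - x_j)] and
    [A = \sum w_i x_i \prod_(j != i) (X - x_j)] ([solution_cycle]). The function
    [A / N] has degree [d - 1], so its second iterate has at most
    [(d - 1) ^ 2 + 1] fixed points; [d] of them are the nodes, which [A / N] fixes
    already, and the others form at most [((d - 1) ^ 2 + 1 - d) / 2 = 'C(d-1, 2)]
    pairs ([solutions_bound]). *)

Set Implicit Arguments.
Unset Strict Implicit.
Unset Printing Implicit Defensive.
Import GRing.Theory Num.Theory.
Local Open Scope ring_scope.

(** * Polynomial functions on lines *)

Section PolynomialFunctions.
Variable C : numDomainType.

Lemma poly_eq0_infinite (p : {poly C}) : (forall t, p.[t] = 0) -> p = 0.
Proof.
move=> p0; apply/eqP/negPn/negP => pn0.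
have /= := max_poly_roots pn0 (rs := [seq i%:R | i <- iota 0 (size p)]).
rewrite size_map size_iota ltnn => H; have := H _ _; case/(_ _ _)/negP => //.
  by apply/allP => x _; rewrite /root p0.
by rewrite map_inj_uniq ?iota_uniq // => i j /eqP; rewrite eqr_nat => /eqP.
Qed.

Variable d : nat.
Implicit Types (x y w : 'I_d -> C) (X : ('I_d -> C) -> Prop).

(** Restriction to lines is all that is used of polynomiality. *)
Definition line_poly (f : ('I_d -> C) -> C) := forall x y,
  exists p : {poly C}, forall t, f (fun i => x i + t * (y i - x i)) = p.[t].

(** Affine subspaces, described by the parametrized lines joining their points. *)
Definition line_closed X := forall x y t,
  X x -> X y -> X (fun i => x i + t * (y i - x i)).

Lemma line_poly_coord i : line_poly (fun x => x i).
Proof.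
by move=> x y; exists ((x i)%:P + 'X * (y i - x i)%:P) => t; rewrite !hornerE.
Qed.

Lemma line_polyC c : line_poly (fun=> c).
Proof. by move=> x y; exists c%:P => t; rewrite hornerC. Qed.

Lemma line_polyM f g :
  line_poly f -> line_poly g -> line_poly (fun x => f x * g x).
Proof.
move=> fP gP x y; have [[p pE] [q qE]] := (fP x y, gP x y).
by exists (p * q) => t; rewrite hornerM -pE -qE.
Qed.

Lemma line_poly_sum (I : finType) (P : pred I) (f : I -> ('I_d -> C) -> C) :
  (forall i, line_poly (f i)) -> line_poly (fun x => \sum_(i | P i) f i x).
Proof.
move=> fP x y; have [p pE] := fin_all_exists (fun i => fP i x y).
by exists (\sum_(i | P i) p i) => t; rewrite horner_sum; apply: eq_bigr.
Qed.

Lemma line_poly_meval n (a : {mpoly C[n]}) (f : ('I_d -> C) -> 'I_n -> C) :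
  (forall i, line_poly (f^~ i)) -> line_poly (fun x => a.@[f x]).
Proof.
move=> fP x y; have [p pE] := fin_all_exists (fun i => fP i x y).
exists (mmap polyC p a) => t; rewrite mevalE /mmap horner_sum.
apply: eq_bigr => m _; rewrite hornerCM /mmap1 horner_prod.
by congr (_ * _); apply: eq_bigr => i _; rewrite horner_exp -pE.
Qed.

(** On the line joining a point where [f] is nonzero to any other point, both
    functions are univariate polynomials over an infinite domain. *)
Lemma vanishing_factor X f g : line_closed X -> line_poly f -> line_poly g ->
  (forall x, X x -> f x * g x = 0) -> (exists2 x, X x & f x != 0) ->
  forall y, X y -> g y = 0.
Proof.
move=> XL fP gP fg0 [x Xx fx] y Xy.
have [[p pE] [q qE]] := (fP x y, gP x y).
have at0 : (fun i => x i + 0 * (y i - x i)) = x.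
  by apply: funext => i; rewrite mul0r addr0.
have at1 : (fun i => x i + 1 * (y i - x i)) = y.
  by apply: funext => i; rewrite mul1r addrCA subrr addr0.
have /eqP : p * q = 0.
  by apply: poly_eq0_infinite => t; rewrite hornerM -pE -qE fg0 //; apply: XL.
rewrite mulf_eq0 => /orP[/eqP p0|/eqP q0].
  by case/eqP: fx; rewrite -at0 pE p0 horner0.
by rewrite -at1 qE q0 horner0.
Qed.

(** Induction on the number of variables, separating the last one. *)
Lemma mpoly_eq0_meval n (a : {mpoly C[n]}) :
  (forall w : 'I_n -> C, a.@[w] = 0) -> a = 0.
Proof.
elim: n a => [|n IHn] a a0.
  by rewrite [a]nvar0_mpolyC; have := a0 (fun=> 0); rewrite {1}[a]nvar0_mpolyC
    mevalC => ->; rewrite mpolyC0.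
pose lower (m : 'X_{1..n.+1}) := [multinom (m (widen_ord (leqnSn n) i)) | i < n].
have muniE' : muni a =
    \sum_(m <- msupp a) a@_m *: 'X_[lower m] *: 'X^(m ord_max) by exact: muniE.
have muni0 : muni a = 0.
  apply/polyP => k; rewrite coef0; apply: IHn => w.
  suff /(congr1 (fun p : {poly C} => p`_k)) : map_poly (meval w) (muni a) = 0.
    by rewrite coef_map coef0.
  apply: poly_eq0_infinite => t.
  rewrite -[RHS](a0 (fun i => if insub (val i) is Some j then w j else t)).
  rewrite muniE' rmorph_sum horner_sum mevalE; apply: eq_bigr => m _ /=.
  rewrite map_polyZ map_polyXn hornerZ hornerXn /= mevalZ mevalX big_ord_recr /=.
  rewrite insubF ?ltnn // -mulrA; congr (_ * (_ * _)).
  by apply: eq_bigr => i _; rewrite mnmE /= valK.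
apply/mpolyP => m0; rewrite mcoeff0.
have /(congr1 (mcoeff (lower m0))) : (muni a)`_(m0 ord_max) = 0 by rewrite muni0 coef0.
rewrite muniE' coef_sum raddf_sum mcoeff0 /= => <-.
rewrite [in LHS](mpolyE a) raddf_sum /=; apply: eq_bigr => m _.
rewrite coefZ coefXn mulr_natr mcoeffMn !mcoeffZ !mcoeffX -mulrnAr -mulrnA mulnb.
congr (_ * (nat_of_bool _)%:R); rewrite andbC [m0 ord_max == _]eq_sym.
apply/idP/idP => [/eqP->|/andP[/eqP mx /eqP/mnmP ml]]; first by rewrite !eqxx.
apply/eqP/mnmP => i; case: (unliftP ord_max i) => [j ->|->] //.
have := ml j; rewrite !mnmE (_ : widen_ord _ j = lift ord_max j) //.
by apply: val_inj; rewrite /= /bump leqNgt ltn_ord.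
Qed.

(** Division with remainder by the [k]-th variable, in terms of values; the
    quotient loses a degree, on which inductions can rest. *)
Lemma mpoly_split_var n (k : 'I_n) (a : {mpoly C[n]}) :
  exists2 b : {mpoly C[n]}, (msize b <= (msize a).-1)%N & forall w : 'I_n -> C,
    a.@[w] = a.@[fun i => if i == k then 0 else w i] + w k * b.@[w].
Proof.
have splitX m : exists2 b : {mpoly C[n]}, (msize b <= mdeg m)%N &
  forall w : 'I_n -> C, ('X_[m] : {mpoly C[n]}).@[w] =
    ('X_[m] : {mpoly C[n]}).@[fun i => if i == k then 0 else w i] + w k * b.@[w].
  have [mk|mk] := eqVneq (m k) 0%N.
    exists 0; first by rewrite msize0.
    move=> w; rewrite meval0 mulr0 addr0 !mevalX; apply: eq_bigr => i _.
    by case: eqP => // ->; rewrite mk !expr0.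
  have dm : m = (U_(k) + (m - U_(k)))%MM by rewrite addmC submK // lep1mP.
  exists 'X_[m - U_(k)].
    by rewrite msizeX {2}dm mdegD mdeg1.
  move=> w; rewrite {1}dm mpolyXD mevalM mevalXU [X in X + _](_ : _ = 0) ?add0r //.
  by rewrite mevalX (bigD1 k) //= eqxx expr0n (negPf mk) mul0r.
have {splitX} [b bP] := choice (fun m =>
  let: ex_intro2 b bm bE := splitX m in ex_intro (fun b => _ /\ _) b (conj bm bE)).
exists (\sum_(m <- msupp a) a@_m *: b m).
  apply: leq_trans (msize_sum _ _ _) _; apply/bigmax_leqP_seq => m ma _.
  have [->|am0] := eqVneq a@_m 0; first by rewrite scale0r msize0.
  rewrite msizeZ //; apply: leq_trans (bP m).1 _.
  by have := msize_mdeg_lt ma; case: (msize a).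
have aE (v : 'I_n -> C) :
    a.@[v] = \sum_(m <- msupp a) a@_m * ('X_[m] : {mpoly C[n]}).@[v].
  by rewrite mevalE; apply: eq_bigr => m _; rewrite mevalX.
move=> w; rewrite !aE raddf_sum mulr_sumr -big_split /=.
by apply: eq_bigr => m _; rewrite mevalZ (bP m).2; ring.
Qed.

End PolynomialFunctions.

(** * Linear independence of products over the moment map *)

Section RelationDescent.
Variables (C : numDomainType) (d : nat).
Implicit Types (T : pred 'I_d) (X : ('I_d -> C) -> Prop).

Definition vanishes_on T (a : {mpoly C[d]}) :=
  forall w : 'I_d -> C, (forall i, ~~ T i -> w i = 0) -> a.@[w] = 0.

(** Descent along the hypersurface [F_k = 0]. If the relation forces every
    coefficient to vanish on [w_k = 0] as soon as it holds on the part of [X]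
    where [F_k = 0], then the coefficients are [w_k * b_s]; since [F_k] is not
    identically zero on the irreducible set [X], the [b_s] satisfy the same
    relation and have smaller degree. [T'] lists the coordinates in which [F]
    varies on [X], and [T] those that are left once [k] is removed. *)
Lemma relation_descent (X : ('I_d -> C) -> Prop) (F : ('I_d -> C) -> 'I_d -> C)
    (T T' : pred 'I_d) (k : 'I_d) (I : finType) (P : pred I)
    (h : I -> ('I_d -> C) -> C) :
  line_closed X -> (forall i, line_poly (F^~ i)) ->
  (forall s, line_poly (h s)) ->
  (forall i, T' i -> i != k -> T i) ->
  (forall x, X x -> forall i, ~~ T' i -> F x i = 0) ->
  (exists2 x, X x & F x k != 0) ->
  (forall a : I -> {mpoly C[d]},
     (forall x, X x -> F x k = 0 -> \sum_(s | P s) (a s).@[F x] * h s x = 0) ->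
     forall s, P s -> vanishes_on T (a s)) ->
  forall a : I -> {mpoly C[d]},
    (forall x, X x -> \sum_(s | P s) (a s).@[F x] * h s x = 0) ->
    forall s, P s -> vanishes_on T' (a s).
Proof.
move=> XL FP hP TT' FT' Fk IH a.
have [n] := ubnP (\max_s msize (a s)); elim: n a => // n IHn a.
rewrite ltnS => an a0 s Ps w wT'.
have aT : forall s, P s -> vanishes_on T (a s) by apply: IH => x Xx _; apply: a0.
have [a_s0|a_sn0] := eqVneq (a s) 0.
  by rewrite a_s0 meval0.
have n_gt0 : (0 < n)%N.
  apply: leq_trans an; apply: (@leq_trans (msize (a s))).
    by rewrite lt0n msize_poly_eq0.
  exact: (leq_bigmax s).
have [b bP] := choice (fun s =>
  let: ex_intro2 b bm bE := mpoly_split_var k (a s) in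
  ex_intro (fun b => _ /\ _) b (conj bm bE)).
have kill s' v : P s' -> (forall i, ~~ T' i -> v i = 0) ->
    (a s').@[v] = v k * (b s').@[v].
  move=> Ps' vT'; rewrite (bP s').2 aT ?add0r // => i Ti.
  by case: (eqVneq i k) => // ik; apply: vT'; apply: contra Ti => /TT'; apply.
rewrite kill // (IHn b) ?mulr0 //.
  rewrite -[X in (_ < X)%N](prednK n_gt0) ltnS; apply/bigmax_leqP => s' _.
  by apply: leq_trans (bP s').1 _; rewrite -!subn1 leq_sub2r // (leq_trans _ an) //;
    exact: (leq_bigmax s').
apply: (vanishing_factor
  (g := fun x : ordinal d -> C => \sum_(s | P s) (b s).@[F x] * h s x) XL (FP k) _ _ Fk).
  by apply: line_poly_sum => s'; apply: line_polyM => //; apply: line_poly_meval.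
move=> x Xx; rewrite mulr_sumr -[RHS](a0 x Xx); apply: eq_bigr => s' Ps'.
by rewrite (kill _ _ Ps') ?mulrA //; apply: FT'.
Qed.

End RelationDescent.

Section Quadrics.
Variables (C : numFieldType) (d : nat) (q : 'I_d -> 'I_d -> C).
Hypothesis qC : forall i j, q i j = q j i.
Hypothesis q_diag : forall i, q i i = 0.
Hypothesis q_off : forall i j, i != j -> q i j != 0.
Implicit Types (x : 'I_d -> C).

Definition polar x (i : 'I_d) : C := \sum_j q i j * x j.

Definition moment x (i : 'I_d) : C := x i * polar x i.

Lemma line_poly_polar i : line_poly (polar^~ i).
Proof.
apply: (@line_poly_sum C d _ xpredT (fun j x => q i j * x j)) => j.
by apply: line_polyM; [exact: line_polyC | exact: line_poly_coord].
Qed.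

Lemma line_poly_moment i : line_poly (moment^~ i).
Proof. apply: line_polyM; [exact: line_poly_coord | exact: line_poly_polar]. Qed.

Lemma polar_line x y t i :
  polar (fun i => x i + t * (y i - x i)) i = polar x i + t * (polar y i - polar x i).
Proof.
rewrite /polar -sumrB mulr_sumr -big_split /=; apply: eq_bigr => j _; ring.
Qed.

(** These linear spaces are the irreducible components that arise when some of the
    products [moment x i] are set to zero. *)
Definition slice (S Z : pred 'I_d) x :=
  (forall i, ~~ S i -> x i = 0) /\ (forall i, Z i -> polar x i = 0).

Lemma line_closed_slice S Z : line_closed (slice S Z).
Proof.
move=> x y t [xS xZ] [yS yZ]; split=> i Hi; first by rewrite xS ?yS ?subr0 ?mulr0 ?addr0.
by rewrite polar_line xZ ?yZ ?subr0 ?mulr0 ?addr0.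
Qed.

Lemma moment_slice S Z x i : slice S Z x -> ~~ (S i && ~~ Z i) -> moment x i = 0.
Proof.
move=> [xS xZ]; rewrite negb_and negbK /moment => /orP[/xS->|/xZ->].
  by rewrite mul0r.
by rewrite mulr0.
Qed.

Lemma polar_pick x (s : seq 'I_d) i : uniq s -> (forall j, j \notin s -> x j = 0) ->
  polar x i = \sum_(j <- s) q i j * x j.
Proof.
move=> us xs; rewrite /polar (bigID (mem s)) /= [X in _ + X]big1 ?addr0.
  by rewrite big_uniq.
by move=> j /xs->; rewrite mulr0.
Qed.

(** Solving [polar x l = polar x m = 0] with [x k = 1] gives
    [x l = - q_mk / q_lm] and [x m = - q_lk / q_lm], hence
    [polar x k = - 2 q_kl q_km / q_lm]: this is the diagonal entry at [k] of the
    Schur complement of the block of [q] indexed by [l] and [m]. *)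
Lemma slice_point (k l m : 'I_d) : k != l -> k != m -> l != m ->
  exists x, [/\ forall i, i \notin [:: k; l; m] -> x i = 0,
    polar x l = 0, polar x m = 0 &
    [/\ x k != 0, x l != 0, x m != 0 & polar x k != 0]].
Proof.
move=> kl km lm.
pose x i := if i == k then 1 else if i == l then - (q m k / q l m)
  else if i == m then - (q l k / q l m) else 0.
have xk : x k = 1 by rewrite /x eqxx.
have xl : x l = - (q m k / q l m) by rewrite /x eq_sym (negPf kl) eqxx.
have xm : x m = - (q l k / q l m).
  by rewrite /x eq_sym (negPf km) eq_sym (negPf lm) eqxx.
have x0 i : i \notin [:: k; l; m] -> x i = 0.
  by rewrite !inE !negb_or /x => /and3P[/negPf-> /negPf-> /negPf->].
have us : uniq [:: k; l; m] by rewrite /= !inE negb_or kl km lm.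
have qlm := q_off lm.
have polarE i : polar x i = q i k - q i l * (q m k / q l m) - q i m * (q l k / q l m).
  by rewrite (polar_pick i us x0) !big_cons big_nil xk xl xm; ring.
exists x; split=> //; rewrite ?polarE ?q_diag.
- by field.
- by rewrite (qC m l); field.
split; rewrite ?xk ?xl ?xm ?oner_eq0 ?oppr_eq0 ?mulf_neq0 ?invr_eq0 ?q_off //.
- by rewrite eq_sym.
- by rewrite eq_sym.
rewrite (qC m k) (qC l k).
have -> : 0 - q k l * (q k m / q l m) - q k m * (q k l / q l m) =
  - (2%:R * q k l * q k m / q l m) by field.
by rewrite oppr_eq0 !mulf_neq0 ?invr_eq0 ?pnatr_eq0 ?q_off.
Qed.

Definition below n : pred 'I_d := fun i => (i < n)%N.

(** The remaining coordinates [F_i], [i < n], are algebraically independent on a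
    slice with two vanishing partial derivatives. It is enough to descend along
    the component [x_k = 0] of [F_k = 0], which lowers [n]. *)
Lemma moment_dominant (l m : 'I_d) n : (n <= l)%N -> (l < m)%N ->
  forall a : {mpoly C[d]},
  (forall x, slice [pred i | [|| below n i, i == l | i == m]]
                   [pred i | (i == l) || (i == m)] x -> a.@[moment x] = 0) ->
  vanishes_on (below n) a.
Proof.
move=> + lm; elim: n => [_|n IHn nl] a a0.
  move=> w w0; rewrite -[RHS](a0 (fun=> 0)); last first.
    by split=> // i _; rewrite /polar big1 // => j _; rewrite mulr0.
  by apply: meval_eq => i; rewrite w0 // /moment mul0r.
pose k : 'I_d := Ordinal (ltn_trans nl (ltn_ord l)).
have kl : k != l by rewrite -val_eqE /= ltn_eqF.
have km : k != m by rewrite -val_eqE /= ltn_eqF // (ltn_trans nl).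
have lm' : l != m by rewrite -val_eqE /= ltn_eqF.
pose X := slice [pred i | [|| below n.+1 i, i == l | i == m]]
                [pred i | (i == l) || (i == m)].
have [y [ys yl ym [yk ynl ynm pyk]]] := slice_point kl km lm'.
apply: (@relation_descent C d X moment (below n) (below n.+1) k unit xpredT
  (fun _ _ => 1) _ _ _ _ _ _ _ (fun=> a) _ tt) => //.
- exact: line_closed_slice.
- exact: line_poly_moment.
- by move=> _; apply: line_polyC.
- move=> i; rewrite /below /= ltnS leq_eqVlt => /orP[/eqP ik|//].
  by case/eqP; apply: val_inj.
- move=> x Xx i; rewrite /below /= -leqNgt => ni.
  apply: (moment_slice Xx) => /=; rewrite /below /= ltnNge ni /=.
  by case: (i == l); case: (i == m).
- exists y; last by rewrite mulf_neq0.
  split=> i /=; last by case/orP=> /eqP->.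
  rewrite !negb_or => /and3P[ni il im]; apply: ys; rewrite !inE !negb_or il im !andbT.
  by apply: contra ni => /eqP->; rewrite /below /=.
- move=> b b0 [] _; apply: IHn; first exact: ltnW.
  move=> x [xS xZ]; have xk : x k = 0.
    by apply: xS; rewrite /= /below /= ltnn (negPf kl) (negPf km).
  have := b0 x.
  rewrite (big_pred1 tt) ?mulr1; last by case.
  apply; last by rewrite /moment xk mul0r.
  split=> // i /=; rewrite !negb_or => /and3P[ni il im]; apply: xS.
  rewrite /= !negb_or il im !andbT; apply: contra ni; rewrite /below /=.
  by move=> /ltn_trans; apply.
- by move=> x Xx; rewrite (big_pred1 tt) ?mulr1 ?a0 //; case.
Qed.

Lemma below_ord n (k : 'I_d) i : k = n :> nat -> below n.+1 i -> i != k -> below n i.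
Proof.
move=> kn; rewrite /below ltnS leq_eqVlt => /orP[/eqP ik|//].
by case/eqP; apply: val_inj; rewrite /= ik kn.
Qed.

(** Independence of the products [x_i x_k] on the hyperplane [polar x k = 0].
    With [l] the last index below [n], the component [x_l = 0] removes the product
    [x_l x_k] and disposes of all other coefficients; on the component
    [polar x l = 0] only that product is left, and [moment_dominant] applies. *)
Lemma relations_facet (k : 'I_d) n : (n <= k)%N ->
  forall b : 'I_d -> {mpoly C[d]},
  (forall x, slice [pred i | below n i || (i == k)] (pred1 k) x ->
     \sum_(i : 'I_d | (0 < i < n)%N) (b i).@[moment x] * (x i * x k) = 0) ->
  forall i : 'I_d, (0 < i < n)%N -> vanishes_on (below n) (b i).
Proof.
elim: n => [|n IHn] nk b b0; first by move=> i; rewrite andbF.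
pose l : 'I_d := Ordinal (ltn_trans nk (ltn_ord k)).
have lk : l != k by rewrite -val_eqE /= ltn_eqF.
have [n0|n_gt0] := posnP n; first by move=> i; rewrite n0 ltnS leqn0 lt0n => /andP[/negPf->].
pose o : 'I_d := Ordinal (leq_ltn_trans (leq0n k) (ltn_ord k)).
have ol : o != l by rewrite -val_eqE /= ltn_eqF.
have ok : o != k by rewrite -val_eqE /= ltn_eqF // (leq_ltn_trans _ nk).
pose X := slice [pred i | below n.+1 i || (i == k)] (pred1 k).
have [y [ys yl yk [yno ynl ynk _]]] := slice_point ol ok lk.
apply: (@relation_descent C d X moment (below n) (below n.+1) l 'I_d
  (fun i : 'I_d => 0 < i < n.+1)%N
  (fun (i : 'I_d) (x : 'I_d -> C) => x i * x k) _ _ _ _ _ _ _ b b0) => //.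
- exact: line_closed_slice.
- exact: line_poly_moment.
- by move=> i; apply: line_polyM; apply: line_poly_coord.
- by move=> i; apply: below_ord.
- move=> x Xx i; rewrite /below -leqNgt => ni.
  by apply: (moment_slice Xx) => /=; rewrite /below ltnNge ni /=; case: (i == k).
- apply: contrapT => F0.
  have Xl x : X x -> x l = 0.
    apply: (vanishing_factor (f := polar^~ l) (g := fun x : 'I_d -> C => x l)
       (line_closed_slice (S := _) (Z := _)) (line_poly_polar l) (line_poly_coord l)).
      move=> {}x Xx; rewrite mulrC; apply: contrapT => /eqP Fx.
      by apply: F0; exists x.
    have up : uniq [:: k] by [].
    pose e (i : 'I_d) : C := (i == k)%:R.
    have pe i : polar e i = q i k.
      rewrite (polar_pick i up) ?big_seq1 /e ?eqxx ?mulr1 //.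
      by move=> j; rewrite inE => /negPf->.
    exists e; last by rewrite pe q_off.
    split=> [i|i /eqP->]; last by rewrite pe.
    by rewrite negb_or => /andP[_ /negPf ik]; rewrite /e ik.
  case/eqP: ynl; apply: Xl; split=> [i|i /eqP->//].
  rewrite /= negb_or => /andP[ni ik]; apply: ys; rewrite !inE !negb_or ik andbT.
  by apply/andP; split; apply: contra ni => /eqP->; rewrite /below //=.
- move=> a a0; have an (i : 'I_d) : (0 < i < n)%N -> vanishes_on (below n) (a i).
    apply: IHn; first exact: ltnW.
    move=> x [xS xZ]; have xl : x l = 0.
      by apply: xS; rewrite /= /below /= ltnn (negPf lk).
    have := a0 x _ _; rewrite (bigD1 l) /= ?ltnSn ?n_gt0 // xl mul0r mulr0 add0r.
    move=> H; rewrite -[RHS]H.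
    + apply: eq_bigl => j; rewrite -val_eqE /=; lia.
    + split=> // j; rewrite /= !negb_or => /andP[nj jk]; apply: xS.
      by rewrite /= negb_or jk andbT; apply: contra nj => /ltn_trans; apply.
    + by rewrite /moment xl mul0r.
  move=> i; rewrite ltnS => /andP[i_gt0].
  rewrite leq_eqVlt => /orP[/eqP il|li]; last by apply: an; rewrite i_gt0.
  have {il i_gt0} -> : i = l by apply: val_inj.
  apply: (@moment_dominant l k) => //.
  pose Y := slice [pred i | [|| below n i, i == l | i == k]]
                  [pred i | (i == l) || (i == k)].
  apply: (vanishing_factor (X := Y) (f := fun x : 'I_d -> C => x l * x k)
    (g := fun x => (a l).@[moment x])).
  + exact: line_closed_slice.
  + by apply: line_polyM; apply: line_poly_coord.
  + by apply: line_poly_meval; apply: line_poly_moment.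
  + move=> x [xS xZ]; have Xx : X x.
      split=> [j|j /eqP->]; last by apply: xZ; rewrite /= eqxx orbT.
      rewrite /= negb_or => /andP[nj jk]; apply: xS.
      rewrite /= (negPf jk) orbF negb_or; apply/andP; split; apply: contra nj.
        by move/ltn_trans; apply.
      by move/eqP->; rewrite /below /=.
    have Fl : moment x l = 0 by rewrite /moment xZ ?mulr0 //= eqxx.
    rewrite mulrC -[RHS](a0 x Xx Fl) (bigD1 l) /= ?n_gt0 //=.
    rewrite big1 ?addr0 // => j /andP[/andP[j0 jn] jl].
    rewrite an ?mul0r ?j0 //=.
      by apply: (@below_ord n l).
    move=> m nm; have [->//|ml] := eqVneq m l.
    apply: (moment_slice Xx) => /=; apply/negP => /andP[/orP[mn|->//]].
    by case/negP: nm; apply: (@below_ord n l).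
  exists y; last by rewrite mulf_neq0.
  split=> [j|j /= /orP[]/eqP-> //].
  rewrite /= !negb_or => /and3P[nj jl jk]; apply: ys.
  rewrite !inE !negb_or jl jk !andbT.
  by apply: contra nj => /eqP->; rewrite /below.
Qed.

(** Independence of the products [x_i x_j], [0 < i < j < n], among the points
    supported on the first [n] coordinates. The component [x_k = 0], [k = n - 1],
    disposes of the products without [x_k], and [relations_facet] of the others.
    Products with [x_0] are excluded because a relation involving them can hold:
    the [F_i] themselves are combinations of all products [x_i x_j]. *)
Lemma relations_prefix n : (n <= d)%N ->
  forall a : 'I_d * 'I_d -> {mpoly C[d]},
  (forall x, (forall i : 'I_d, (n <= i)%N -> x i = 0) ->
     \sum_(s : 'I_d * 'I_d | (0 < s.1 < s.2)%N && (s.2 < n)%N)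
        (a s).@[moment x] * (x s.1 * x s.2) = 0) ->
  forall s : 'I_d * 'I_d, (0 < s.1 < s.2)%N && (s.2 < n)%N ->
  vanishes_on (below n) (a s).
Proof.
elim: n => [|n IHn] nd a a0; first by move=> s; rewrite andbF.
pose k : 'I_d := Ordinal nd.
have [n0|n_gt0] := posnP n.
  by move=> s; rewrite n0 ltnS leqn0 => /andP[/andP[_ +] /eqP s0]; rewrite s0.
pose o : 'I_d := Ordinal (leq_ltn_trans (leq0n n) nd).
have ok : o != k by rewrite -val_eqE /= ltn_eqF.
pose X x := forall i : 'I_d, (n.+1 <= i)%N -> x i = 0 :> C.
have XS x : X x <-> slice (below n.+1) xpred0 x.
  split=> [Xx|[xS _] i ni]; last by apply: xS; rewrite /below -leqNgt.
  by split=> // i; rewrite /below -leqNgt; apply: Xx.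
apply: (@relation_descent C d X moment (below n) (below n.+1) k ('I_d * 'I_d)%type
  (fun s : 'I_d * 'I_d => (0 < s.1 < s.2)%N && (s.2 < n.+1)%N)
  (fun (s : 'I_d * 'I_d) (x : 'I_d -> C) => x s.1 * x s.2)
  _ _ _ _ _ _ _ a a0) => //.
- by move=> x y t /XS Xx /XS Xy; apply/XS; apply: line_closed_slice.
- exact: line_poly_moment.
- by move=> s; apply: line_polyM; apply: line_poly_coord.
- by move=> i; apply: below_ord.
- by move=> x Xx i; rewrite /below -leqNgt => /Xx xi; rewrite /moment xi mul0r.
- pose e (i : 'I_d) : C := (i \in [:: o; k])%:R.
  have up : uniq [:: o; k] by rewrite /= inE ok.
  have ek : e k = 1 by rewrite /e !inE eqxx orbT.
  have eo : e o = 1 by rewrite /e !inE eqxx.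
  have pe i : polar e i = q i o + q i k.
    rewrite (polar_pick i up) ?big_cons ?big_nil ?ek ?eo ?addr0 ?mulr1 //.
    by move=> j jn; rewrite /e (negPf jn).
  exists e; last by rewrite /moment ek mul1r pe q_diag addr0 q_off // eq_sym.
  move=> i ni; rewrite /e !inE -!val_eqE /=.
  by rewrite !gtn_eqF // (leq_ltn_trans _ ni).
move=> b b0; have bn (s : 'I_d * 'I_d) : (0 < s.1 < s.2)%N && (s.2 < n)%N ->
    vanishes_on (below n) (b s).
  apply: IHn; first exact: ltnW.
  move=> x xS; have xk : x k = 0 by apply: xS.
  have := b0 x _ _; rewrite (bigID (fun s : 'I_d * 'I_d => s.2 == k)) /=.
  rewrite [X in X + _]big1 ?add0r; last by move=> r /andP[_ /eqP->]; rewrite xk !mulr0.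
  move=> H; rewrite -[RHS]H.
  + apply: eq_bigl => r; rewrite -val_eqE /=; lia.
  + by move=> i /ltnW; apply: xS.
  + by rewrite /moment xk mul0r.
move=> [i j] /= /andP[/andP[i0 ij] jn].
have [jk|jk] := eqVneq j k; last by apply: bn; rewrite /= i0 ij; apply: (@below_ord n k).
have ik : (i < k)%N by rewrite -jk.
rewrite jk => {j jk ij jn}.
apply: (@relations_facet k n (leqnn _) (fun i => b (i, k))); last by rewrite i0 ik.
move=> x [xS xZ]; have Xx : X x.
  move=> j nj; apply: xS; rewrite /= /below negb_or -leqNgt ltnW //=.
  by rewrite -val_eqE /= gtn_eqF.
have Fk : moment x k = 0 by rewrite /moment xZ ?mulr0 //=.
rewrite -[RHS](b0 x Xx Fk) (bigID (fun s : 'I_d * 'I_d => s.2 == k)) /=.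
rewrite [X in _ + X]big1 ?addr0.
  rewrite (reindex_onto (fun i : 'I_d => (i, k)) fst) /=; last first.
    by case=> u v /= /andP[_ /eqP->].
  by apply: eq_bigl => u; rewrite ltnSn !eqxx !andbT.
move=> [u v] /= /andP[/andP[/andP[u0 uv] vn] vk].
rewrite bn ?mul0r //=; first by rewrite u0 uv; apply: (@below_ord n k).
move=> m nm; have [->//|mk] := eqVneq m k.
have [mn|mn] := leqP n.+1 m; first by rewrite /moment Xx ?mul0r.
by case/negP: nm; apply: (@below_ord n k).
Qed.

Lemma products_independent (a : 'I_d * 'I_d -> {mpoly C[d]}) :
  (forall x, \sum_(s : 'I_d * 'I_d | (0 < s.1 < s.2)%N)
     (a s).@[moment x] * (x s.1 * x s.2) = 0) ->
  forall s : 'I_d * 'I_d, (0 < s.1 < s.2)%N -> a s = 0.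
Proof.
move=> a0 s Ps; apply: mpoly_eq0_meval => w.
apply: (@relations_prefix d (leqnn d) a) => [x _| |i].
- rewrite -[RHS](a0 x); apply: eq_bigl => s'.
  by rewrite ltn_ord andbT.
- by rewrite Ps ltn_ord.
- by rewrite /below ltn_ord.
Qed.

End Quadrics.

(** * Algebraic dependence *)

Section AlgebraicDependence.
Variables (C : fieldType) (n : nat).
Implicit Types p q x : {mpoly C[n]}.

Lemma msizeM_leq p q a b :
  (msize p <= a.+1)%N -> (msize q <= b.+1)%N -> (msize (p * q) <= (a + b).+1)%N.
Proof.
have [->|p0] := eqVneq p 0; first by rewrite mul0r msize0.
have [->|q0] := eqVneq q 0; first by rewrite mulr0 msize0.
by rewrite msizeM //; move: (msize p) (msize q) => u v; lia.
Qed.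

Lemma msizeX_leq p a k : (msize p <= a.+1)%N -> (msize (p ^+ k) <= (k * a).+1)%N.
Proof.
move=> pa; elim: k => [|k IHk]; first by rewrite expr0 msizeC oner_eq0.
by rewrite exprS mulSn; apply: msizeM_leq.
Qed.

(** The monomials of bounded degree in [n + 1] given polynomials in [n] variables
    outnumber the monomials that occur in their expansions, so some nonzero
    combination of them vanishes. *)
Lemma algebraic_dependence (F : 'I_n -> {mpoly C[n]}) x :
  exists2 G : {poly {mpoly C[n]}}, G != 0 &
    (map_poly (comp_mpoly [tuple F i | i < n]) G).[x] = 0.
Proof.
have [b [Fb xb]] : exists b, (forall i, msize (F i) <= b.+1)%N /\ (msize x <= b.+1)%N.
  exists (\max_i msize (F i) + msize x)%N; split=> [i|]; last by lia.
  by have := leq_bigmax (F := fun i => msize (F i)) i; lia.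
(* The monomials with exponents below D in the n.+1 polynomials have degree below
   M <= (n.+1 * b).+1 * D, and M ^ n < D ^ n.+1 by the choice of D. *)
pose D := ((n.+1 * b).+1 ^ n).+1; pose M := (n.+1 * b * D).+1.
pose I := ({ffun 'I_n -> 'I_D} * 'I_D)%type; pose J := {ffun 'I_n -> 'I_M}.
pose term (s : I) := (\prod_i F i ^+ s.1 i) * x ^+ s.2.
pose mon N (f : {ffun 'I_n -> 'I_N}) := [multinom (f i : nat) | i < n].
have term_size s : (msize (term s) <= M)%N.
  have -> : M = (n * (D * b) + D * b).+1 by rewrite /M; lia.
  have exp_size p (k : 'I_D) : (msize p <= b.+1 -> msize (p ^+ k) <= (D * b).+1)%N.
    move=> /(@msizeX_leq _ _ k)/leq_trans; apply.
    by rewrite ltnS leq_mul2r (ltnW (ltn_ord k)) orbT.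
  apply: msizeM_leq; last exact: exp_size.
  rewrite -[n in (n * _)%N]card_ord -sum_nat_const.
  elim/big_ind2: _ => [|p1 a1 p2 a2 h1 h2|i _]; first by rewrite msizeC oner_eq0.
    exact: msizeM_leq.
  exact: exp_size.
have ltJI : (#|{: J}| < #|{: I}|)%N.
  rewrite card_prod !card_ffun !card_ord.
  apply: (@leq_ltn_trans (((n.+1 * b).+1 * D) ^ n)).
    have [n0|n_gt0] := posnP n; first by rewrite [X in (_ ^ X)%N]n0 [X in (_ <= _ ^ X)%N]n0.
    by rewrite leq_exp2r // /M; lia.
  by rewrite expnMn mulnC ltn_pmul2l // expn_gt0.
pose A : 'M[C]_(#|{: I}|, #|{: J}|) :=
  \matrix_(s, f) (term (enum_val s))@_(mon _ (enum_val f)).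
have /rowV0Pn[v /sub_kermxP vA v0] : kermx A != 0.
  rewrite kermx_eq0 /row_free neq_ltn; apply/orP; left.
  exact: leq_ltn_trans (rank_leq_col A) ltJI.
pose c s := v 0 (enum_rank s).
have sum0 : \sum_s c s *: term s = 0.
  apply/mpolyP => m; rewrite mcoeff0 raddf_sum /=.
  have [mM|NmM] := boolP [forall i, m i < M]%N; last first.
    have [i Mm] : exists i, (M <= m i)%N.
      by move: NmM => /fintype.forallPn [i Mm]; exists i; rewrite leqNgt.
    apply: big1 => s _.
    rewrite mcoeffZ memN_msupp_eq0 ?mulr0 // msize_mdeg_ge //.
    apply: leq_trans (term_size s) (leq_trans Mm _).
    by rewrite mdegE (bigD1 i) //= leq_addr.
  pose f : J := [ffun i => inord (m i)].
  have mE : m = mon _ f.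
    by apply/mnmP => i; rewrite mnmE ffunE inordK //; apply: (forallP mM).
  have /matrixP/(_ 0 (enum_rank f)) := vA; rewrite !mxE => vA0.
  rewrite -[RHS]vA0 (reindex_onto enum_val enum_rank) /=; last first.
    by move=> s _; rewrite enum_rankK.
  apply: eq_big => [s|s _]; first by rewrite enum_valK eqxx.
  by rewrite mcoeffZ /c enum_valK mxE enum_rankK mE.
have [s0 cs0] : exists s, c s != 0.
  have /rV0Pn[j vj] := v0; exists (enum_val j); by rewrite /c enum_valK.
exists (\sum_s (c s *: 'X_[mon _ s.1]) *: 'X^(s.2)).
  apply/eqP => /polyP/(_ s0.2)/mpolyP/(_ (mon _ s0.1)).
  rewrite coef0 mcoeff0 coef_sum raddf_sum (bigD1 s0) //= big1 ?addr0.
    by rewrite coefZ coefXn eqxx mulr1 mcoeffZ mcoeffX eqxx mulr1; apply/eqP.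
  move=> [f k] /= fk; rewrite coefZ coefXn.
  have [sk|_] := eqVneq; last by rewrite mulr0 mcoeff0.
  rewrite mulr1 mcoeffZ mcoeffX; case: eqP => [fE|_]; last by rewrite mulr0.
  case/eqP: fk; case: (s0) sk fE => f0 k0 /= /val_inj -> /mnmP fE; congr (_, _).
  by apply/ffunP => i; apply: val_inj; have := fE i; rewrite !mnmE.
rewrite -[RHS]sum0 raddf_sum horner_sum; apply: eq_bigr => s _.
rewrite /= map_polyZ /= map_polyXn hornerZ hornerXn comp_mpolyZ comp_mpolyX.
rewrite -scalerAl; congr (_ *: (_ * _)); apply: eq_bigr => i _.
by rewrite tnth_mktuple mnmE.
Qed.

End AlgebraicDependence.

(** * Primitive elements over a subring *)

Section QuotientSubfield.
Variables (A : idomainType) (L : fieldType) (phi : {rmorphism A -> L}).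

Definition quotient_pred : {pred L} :=
  fun x => `[< exists a b, phi b != 0 /\ x = phi a / phi b >].

Lemma quotientP x :
  reflect (exists a b, phi b != 0 /\ x = phi a / phi b) (x \in quotient_pred).
Proof. exact: asboolP. Qed.

Fact quotient_divring_closed : divring_closed quotient_pred.
Proof.
split.
- by apply/quotientP; exists 1, 1; rewrite rmorph1 divr1 oner_eq0.
- move=> _ _ /quotientP[a [b [b0 ->]]] /quotientP[a' [b' [b'0 ->]]].
  apply/quotientP; exists (a * b' - a' * b), (b * b').
  rewrite rmorphM mulf_neq0 // rmorphB !rmorphM; split=> //.
  by field; rewrite b0 b'0.
- move=> _ _ /quotientP[a [b [b0 ->]]] /quotientP[a' [b' [b'0 ->]]].
  apply/quotientP; have [a'0|a'0] := eqVneq (phi a') 0.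
    by exists 0, 1; rewrite a'0 !rmorph0 rmorph1 oner_eq0 !(mul0r, invr0, mulr0).
  exists (a * b'), (b * a'); rewrite !rmorphM mulf_neq0 //; split=> //.
  by field; rewrite ?b0 ?a'0 ?b'0.
Qed.

HB.instance Definition _ :=
  GRing.isDivringClosed.Build L quotient_pred quotient_divring_closed.

(** The field of fractions of the image of [A], realized inside [L] so that it
    comes with its embedding. *)
Record quotientK :=
  QuotientK { quotient_val :> L; _ : quotient_val \in quotient_pred }.
HB.instance Definition _ := [isSub for quotient_val].
HB.instance Definition _ := [Choice of quotientK by <:].
HB.instance Definition _ := [SubChoice_isSubIntegralDomain of quotientK by <:].
HB.instance Definition _ := [SubIntegralDomain_isSubField of quotientK by <:].

Definition quotient_iota : {rmorphism quotientK -> L} := \val.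

Fact quotient_image a : phi a \in quotient_pred.
Proof. by apply/quotientP; exists a, 1; rewrite rmorph1 divr1 oner_eq0. Qed.

Definition to_quotient a : quotientK := QuotientK (quotient_image a).

Lemma clear_denominators (I : finType) (x : I -> quotientK) :
  exists2 b, phi b != 0 & exists a, forall i, phi b * quotient_iota (x i) = phi (a i).
Proof.
have [a aP] := fin_all_exists (fun i => quotientP _ (valP (x i))).
have [b bP] := fin_all_exists aP.
exists (\prod_i b i).
  by rewrite rmorph_prod; apply/prodf_neq0 => i _; case: (bP i).
exists (fun i => (\prod_(j | j != i) b j) * a i) => i.
rewrite (bigD1 i) //= !rmorphM; have [b0 ->] := bP i.
by field.
Qed.

End QuotientSubfield.

Section PrimitivePresentation.
Variables (A : idomainType) (L : fieldType) (phi : {rmorphism A -> L}).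
Hypothesis phi_inj : injective phi.
Hypothesis pcharL : [pchar L] =i pred0.

Local Notation K := (quotientK phi).
Local Notation iota := (quotient_iota phi).
Local Notation Phi z G := ((map_poly phi G).[z]).

Lemma phi_eq0 a : (phi a == 0) = (a == 0).
Proof. by apply/eqP/eqP => [H|->]; [apply: phi_inj; rewrite H|]; rewrite rmorph0. Qed.

Lemma poly_clear_denominators (p : {poly K}) :
  exists2 b, b != 0 & exists G : {poly A}, map_poly phi G = phi b *: map_poly iota p.
Proof.
have [b b0 [a aE]] := clear_denominators (fun i : 'I_(size p) => p`_i).
exists b; first by rewrite -phi_eq0.
exists (\poly_(i < size p) (if insub i is Some j then a j else 0)).
apply/polyP => k; rewrite coefZ !coef_map coef_poly.
case: ltnP => kp; last by rewrite nth_default // !raddf0 mulr0.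
rewrite (insubT (fun i => (i < size p)%N) kp); exact: esym (aE (Sub k kp)).
Qed.

Lemma algebraicOver_iota (G : {poly A}) x :
  G != 0 -> Phi x G = 0 -> algebraicOver iota x.
Proof.
move=> G0 Gx; pose p := \poly_(i < size G) to_quotient phi G`_i.
have pE : map_poly iota p = map_poly phi G.
  apply/polyP => k; rewrite !coef_map coef_poly.
  by case: ltnP => // kG; rewrite nth_default // !raddf0.
exists p; last by rewrite pE /root Gx.
by rewrite -(map_poly_eq0 iota) pE map_poly_eq0_id0 // phi_eq0 lead_coef_eq0.
Qed.

Lemma primitive_element (I : eqType) (s : seq I) (x : I -> L) : uniq s ->
  (forall i, algebraicOver iota (x i)) ->
  exists n : I -> nat, let z := \sum_(i <- s) x i *+ n i in
    forall i, i \in s -> exists p : {poly K}, x i = (map_poly iota p).[z].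
Proof.
move=> us xalg; elim: s us => [_|i s IHs /andP[si us]]; first by exists (fun=> 0).
have [n] := IHs us; set z := \sum_(j <- s) _ => /= zP.
have [rx nz_rx rx0] := xalg i.
have [rz nz_rz rz0] : algebraicOver iota (- z).
  apply: algebraic_opp; rewrite /z.
  elim/big_ind: _ => [|u v|j _]; [exact: algebraic0|exact: algebraic_add|].
  rewrite -mulr_natr -(rmorph_nat iota).
  by apply: algebraic_mul => //; apply: algebraic_id.
have pcharK : [pchar K] =i pred0.
  by move=> p; rewrite -(pcharL p) !inE -(fmorph_eq0 iota) rmorph_nat.
have [k [[pz Dpz] [px Dpx]]] := pchar0_PET nz_rz rz0 nz_rx rx0 pcharK.
rewrite opprK in Dpz Dpx.
exists (fun j => if j == i then k else n j); rewrite big_cons eqxx /=.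
have -> : \sum_(j <- s) x j *+ (if j == i then k else n j) = z.
  rewrite /z big_seq [RHS]big_seq; apply: eq_bigr => j js.
  by case: eqP js si => // -> ->.
move=> j; rewrite inE => /orP[/eqP->|js]; first by exists px.
have [p ->] := zP j js; exists (p \Po (- pz)).
by rewrite (map_comp_poly iota) horner_comp raddfN /= hornerN Dpz opprK.
Qed.

(** The primitive element theorem with all denominators cleared. Everything is
    expressed by polynomials over the domain [A], to which evaluation
    homomorphisms of [A] apply; over the field of fractions they would only be
    partially defined. *)
Lemma primitive_presentation (I : finType) (x : I -> L) :
  (forall i, algebraicOver iota (x i)) ->
  exists (n : I -> nat) (z := \sum_i x i *+ n i) (P : {poly A}) (e : A)
         (r : I -> {poly A}),
  [/\ P != 0, Phi z P = 0, forall G, G != 0 -> Phi z G = 0 -> (size P <= size G)%N,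
      e != 0 & forall i, phi e * x i = Phi z (r i)].
Proof.
move=> xalg; have [n] := primitive_element (enum_uniq I) xalg.
rewrite big_enum /=; set z := \sum_i _ => zP; exists n; rewrite -/z.
have : exists k, `[< exists2 G : {poly A}, G != 0 & Phi z G = 0 /\ size G = k >].
  have [p p0 pz] : algebraicOver iota z.
    rewrite /z; elim/big_ind: _ => [|u v|j _]; [exact: algebraic0|exact: algebraic_add|].
    rewrite -mulr_natr -(rmorph_nat iota).
    by apply: algebraic_mul => //; apply: algebraic_id.
  have [b b0 [G GE]] := poly_clear_denominators p.
  exists (size G); apply/asboolP; exists G; last first.
    by rewrite GE hornerZ (eqP pz) mulr0.
  have : map_poly phi G != 0.
    by rewrite GE scaler_eq0 phi_eq0 (negPf b0) map_poly_eq0.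
  by apply: contra => /eqP->; rewrite raddf0.
case/ex_minnP => k /asboolP[P P0 [Pz Pk]] kmin.
have xP i : exists bG : A * {poly A}, bG.1 != 0 /\ phi bG.1 * x i = Phi z bG.2.
  have [p ->] := zP i (mem_enum _ _).
  have [b b0 [G GE]] := poly_clear_denominators p.
  by exists (b, G); rewrite GE hornerZ.
have [bG bGP] := fin_all_exists xP.
exists P, (\prod_i (bG i).1), (fun i => (\prod_(j | j != i) (bG j).1) *: (bG i).2).
split=> // [G G0 Gz||i].
- by rewrite Pk; apply: kmin; apply/asboolP; exists G.
- by apply/prodf_neq0 => i _; case: (bGP i).
rewrite (map_polyZ phi) hornerZ -(bGP i).2 (bigD1 i) //= !rmorphM.
by ring.
Qed.

(** The remainder of the pseudo-division of [G] by [P] annihilates [z] and is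
    smaller than [P], hence it is zero. *)
Lemma minimal_divides z (P G : {poly A}) : P != 0 -> Phi z P = 0 ->
  (forall G, G != 0 -> Phi z G = 0 -> (size P <= size G)%N) ->
  Phi z G = 0 -> exists2 c, c != 0 & exists Q, c *: G = Q * P.
Proof.
move=> P0 Pz Pmin Gz; exists (lead_coef P ^+ scalp G P).
  by rewrite expf_neq0 // lead_coef_eq0.
exists (G %/ P); rewrite Pdiv.Idomain.divp_eq [X in _ + X = _](_ : _ = 0) ?addr0 //.
apply/eqP/negPn/negP => R0; have := Pmin _ R0; rewrite leqNgt ltn_modp P0.
move=> H; suff /H : Phi z (G %% P) = 0 by [].
have := congr1 (fun G => Phi z G) (Pdiv.Idomain.divp_eq G P).
by rewrite /= (map_polyZ phi) hornerZ Gz mulr0 (rmorphD (map_poly phi)) hornerD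
  (rmorphM (map_poly phi)) hornerM Pz mulr0 add0r => <-.
Qed.

(** A common factor of [P] and its derivative cannot vanish at [z], because the
    derivative does not; its cofactor in [P] would then be a smaller annihilator
    of [z]. The resultant is thus a nonzero constant in the ideal that [P] and
    its derivative generate. *)
Lemma minimal_coprime_deriv z (P : {poly A}) : P != 0 -> Phi z P = 0 ->
  (forall G, G != 0 -> Phi z G = 0 -> (size P <= size G)%N) ->
  exists2 c, c != 0 & exists u v, c%:P = u * P + v * P^`().
Proof.
move=> P0 Pz Pmin.
have P1 : (1 < size P)%N.
  rewrite ltnNge; apply/negP => /size1_polyC PE.
  by move: Pz P0; rewrite PE map_polyC hornerC polyC_eq0 => /eqP; rewrite phi_eq0 => ->.
have natA n : (n.+1%:R : A) != 0.
  by rewrite -phi_eq0 rmorph_nat ((pcharf0P L).1 pcharL).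
have szP' : (size P^`() < size P)%N by rewrite lt_size_deriv.
have P'0 : P^`() != 0.
  apply/eqP => /polyP/(_ (size P).-2); rewrite coef_deriv coef0 => /eqP.
  rewrite -mulr_natr mulf_eq0 (negPf (natA _)) orbF.
  case E: (size P) P1 => [|[|n]] // _ /=.
  by move: P0; rewrite -lead_coef_eq0 lead_coefE E /= => /negPf->.
have P'z : Phi z P^`() != 0.
  by apply/eqP => /(Pmin _ P'0); rewrite leqNgt szP'.
have [P'1|P'1] := leqP (size P^`()) 1.
  have P'E := size1_polyC P'1; exists (P^`()`_0).
    by apply: contraNneq P'0; rewrite {2}P'E => ->; rewrite polyC0.
  by exists 0, 1; rewrite -P'E mul0r mul1r add0r.
exists (resultant P P^`()); last first.
  by have [[u v] _ E] := resultant_in_ideal P1 P'1; exists u, v.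
rewrite resultant_eq0 -leqNgt leqNgt; apply/negP => g1.
set g := gcdp P P^`() in g1.
have /Pdiv.Idomain.dvdpP [[c1 Q1] /= c10 E1] : g %| P := dvdp_gcdl _ _.
have /Pdiv.Idomain.dvdpP [[c2 Q2] /= c20 E2] : g %| P^`() := dvdp_gcdr _ _.
have gz : Phi z g != 0.
  apply: contraNneq P'z => gz; have := congr1 (fun G => Phi z G) E2.
  rewrite /= (map_polyZ phi) hornerZ (rmorphM (map_poly phi)) hornerM gz mulr0.
  by move/eqP; rewrite mulf_eq0 phi_eq0 (negPf c20).
have Q10 : Q1 != 0.
  apply: contra_eq_neq E1 => ->; rewrite mul0r.
  by rewrite scale_poly_eq0 (negPf c10) (negPf P0).
have : Phi z Q1 = 0.
  have := congr1 (fun G => Phi z G) E1.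
  rewrite /= (map_polyZ phi) hornerZ (rmorphM (map_poly phi)) hornerM Pz mulr0.
  by move/eqP; rewrite eq_sym mulf_eq0 (negPf gz) orbF => /eqP.
move/(Pmin _ Q10); rewrite leqNgt => /negP; apply.
have g0 : g != 0 by rewrite -size_poly_gt0 ltnW.
rewrite -(size_scale P c10) E1 size_mul //.
by case: (size g) g1 => [|[|n]] // _; rewrite !addnS /= ltnS leq_addr.
Qed.

(** Modulo [P] the [y_j] become vectors with [(size P).-1] coordinates over the
    field of fractions of [A]. *)
Lemma independent_card z (P : {poly A}) (J : finType) (y : J -> L)
    (e : J -> A) (t : J -> {poly A}) :
  P != 0 -> Phi z P = 0 -> (forall j, e j != 0) ->
  (forall j, phi (e j) * y j = Phi z (t j)) ->
  (forall a : J -> A, \sum_j phi (a j) * y j = 0 -> forall j, a j = 0) ->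
  (#|J| <= (size P).-1)%N.
Proof.
move=> P0 Pz e0 tE ind; rewrite leqNgt; apply/negP => ltJ.
pose m := (size P).-1.
pose c j := lead_coef P ^+ scalp (t j) P.
have c0 j : c j != 0 by rewrite expf_neq0 // lead_coef_eq0.
have rE j : phi (c j * e j) * y j = Phi z (t j %% P).
  rewrite rmorphM -mulrA tE.
  have := congr1 (fun G => Phi z G) (Pdiv.Idomain.divp_eq (t j) P).
  by rewrite /= (map_polyZ phi) hornerZ => ->; rewrite (rmorphD (map_poly phi)) hornerD
    (rmorphM (map_poly phi)) hornerM Pz mulr0 add0r.
pose M : 'M[K]_(#|J|, m) := \matrix_(j, k) to_quotient phi (t (enum_val j) %% P)`_k.
have /rowV0Pn[v /sub_kermxP vM v0] : kermx M != 0.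
  rewrite kermx_eq0 /row_free neq_ltn; apply/orP; left.
  exact: leq_ltn_trans (rank_leq_col M) ltJ.
have [b b0 [a aE]] := clear_denominators (fun j : J => v 0 (enum_rank j)).
have sum0 k : \sum_j phi (a j) * phi (t j %% P)`_k = 0.
  have [km|km] := ltnP k m; last first.
    apply: big1 => j _; rewrite nth_default ?rmorph0 ?mulr0 //.
    apply: leq_trans km; rewrite -ltnS /m prednK ?size_poly_gt0 //.
    by rewrite ltn_modp.
  have /matrixP/(_ 0 (Ordinal km)) := vM; rewrite !mxE => /(congr1 iota).
  rewrite raddf_sum raddf0 => /(congr1 ( *%R (phi b))); rewrite mulr0 mulr_sumr => vM0.
  rewrite -[RHS]vM0.
  rewrite (reindex_onto (enum_val : 'I_#|J| -> J) enum_rank) /=; last first.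
    by move=> j _; rewrite enum_rankK.
  rewrite (eq_bigl xpredT); last by move=> j; rewrite enum_valK eqxx.
  by apply: eq_bigr => j _; rewrite -aE enum_valK !mxE -mulrA.
have : \sum_j phi (a j * (c j * e j)) * y j = 0.
  transitivity (Phi z (\sum_j a j *: (t j %% P))).
    rewrite raddf_sum horner_sum; apply: eq_bigr => j _.
    rewrite rmorphM -mulrA rE -hornerZ; congr _.[z].
    exact: esym (map_polyZ phi _ _).
  rewrite [X in map_poly _ X](_ : _ = 0) ?raddf0 ?horner0 //.
  apply/polyP => k; rewrite coef0 coef_sum; apply: phi_inj.
  rewrite raddf0 -[RHS](sum0 k) raddf_sum; apply: eq_bigr => j _.
  by rewrite coefZ; apply: rmorphM.
move/ind => a0; case/eqP: v0; apply/rowP => j; rewrite mxE.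
have := aE (enum_val j); rewrite enum_valK.
have -> : a (enum_val j) = 0.
  have /eqP := a0 (enum_val j).
  by rewrite !mulf_eq0 (negPf (c0 _)) (negPf (e0 _)) !orbF => /eqP.
rewrite rmorph0 => /eqP; rewrite mulf_eq0 (negPf b0) /= => /eqP vj.
by apply: val_inj.
Qed.

End PrimitivePresentation.

(** * Specialization of a minimal polynomial *)

Section Specialization.
Variables (C : closedFieldType) (n : nat) (L : fieldType).
Variable phi : {rmorphism {mpoly C[n]} -> L}.
Hypothesis phi_inj : injective phi.
Hypothesis pcharL : [pchar L] =i pred0.
Local Notation Phi z G := ((map_poly phi G).[z]).

(** A polynomial [G i] that annihilates [z] is, up to a nonzero element of the
    base ring, a multiple of [P]. Outside the zeros of these elements, of the
    leading coefficient of [P] and of a resultant, the specialized [P] keeps its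
    degree, has simple roots, and all its roots are roots of the specialized
    [G i]. *)
Lemma specialize_roots z (P : {poly {mpoly C[n]}}) (I : finType)
    (G : I -> {poly {mpoly C[n]}}) :
  P != 0 -> Phi z P = 0 ->
  (forall G, G != 0 -> Phi z G = 0 -> (size P <= size G)%N) ->
  (forall i, Phi z (G i) = 0) ->
  exists2 g : {mpoly C[n]}, g != 0 & forall w : 'I_n -> C, g.@[w] != 0 ->
    exists2 s : seq C, uniq s /\ size s = (size P).-1 &
      forall t, t \in s -> forall i, (map_poly (meval w) (G i)).[t] = 0.
Proof.
move=> P0 Pz Pmin Gz.
have [c c0 [u [v cE]]] := minimal_coprime_deriv phi_inj pcharL P0 Pz Pmin.
have dvd i : exists eQ : {mpoly C[n]} * {poly {mpoly C[n]}},
    eQ.1 != 0 /\ eQ.1 *: G i = eQ.2 * P.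
  by have [e e0 [Q QE]] := minimal_divides P0 Pz Pmin (Gz i); exists (e, Q).
have [eQ eQP] := fin_all_exists dvd.
exists (lead_coef P * c * \prod_i (eQ i).1).
  rewrite !mulf_neq0 ?lead_coef_eq0 //; apply/prodf_neq0 => i _.
  by case: (eQP i).
move=> w; rewrite !mevalM rmorph_prod !mulf_eq0 !negb_or => /andP[/andP[Pw cw] ew].
pose Pw' := map_poly (meval w) P.
have szPw : size Pw' = size P by rewrite size_map_poly_id0.
have Pw0 : Pw' != 0 by rewrite -size_poly_eq0 szPw size_poly_eq0.
have [s sE] := closed_field_poly_normal Pw'.
have lP : lead_coef Pw' != 0 by rewrite lead_coef_eq0.
exists s; first split.
- rewrite -separable_prod_XsubC -(eqp_separable (eqp_scale _ lP)) -sE.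
  rewrite unlock; apply/Bezout_coprimepP.
  exists (map_poly (meval w) u, map_poly (meval w) v) => /=.
  have cwE := congr1 (map_poly (meval w)) cE.
  rewrite deriv_map -!(rmorphM (map_poly (meval w))) -(rmorphD (map_poly (meval w))).
  by rewrite -[X in X %= 1]cwE [X in X %= 1](map_polyC (meval w)) polyC_eqp1.
- by rewrite -szPw sE size_scale // size_prod_XsubC.
move=> t ts i; have /rootP Pt : root Pw' t by rewrite sE rootZ // root_prod_XsubC.
have := congr1 (fun G => (map_poly (meval w) G).[t]) (eQP i).2.
rewrite /= (map_polyZ (meval w)) hornerZ (rmorphM (map_poly (meval w))) hornerM.
rewrite [X in _ = _ * X]Pt mulr0 => /eqP; rewrite mulf_eq0 => /orP[|/eqP//].
by move: ew => /prodf_neq0/(_ i isT)/negPf->.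
Qed.

End Specialization.

(** * Solutions of the moment equations for generic weights *)

(* Homogeneous equations in [t], [u], [v] rewritten for [E * t ^+ 2] and the
   quotients [E * (u / t)], where [E] plays the part of a common denominator. *)
Section Identities.
Variable K : fieldType.
Implicit Types E t u v S : K.

Lemma product_identity E t u v : t != 0 ->
  E ^+ 3 * (u * v) = E * t ^+ 2 * (E * (u / t)) * (E * (v / t)).
Proof. by move=> t0; field. Qed.

Lemma moment_identity E t u S : t != 0 ->
  E * t ^+ 2 * (E * (u / t)) * (E / t * S) - u * S * E ^+ 3 = 0.
Proof. by move=> t0; field. Qed.

Lemma coefficient_identity E t u v : v * (E * (u / t)) = E / t * (v * u).
Proof. by ring. Qed.

Lemma multiple_identity E u n : E * (u *+ n) - n%:R * (E * u) = 0.
Proof. by rewrite -mulr_natr; ring. Qed.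

End Identities.

Section GenericSolutions.
Variables (C : numClosedFieldType) (d : nat) (q : 'I_d -> 'I_d -> C).
Hypothesis qC : forall i j, q i j = q j i.
Hypothesis q_diag : forall i, q i i = 0.
Hypothesis q_off : forall i j, i != j -> q i j != 0.
Variables (o : 'I_d) (s0 : 'I_d * 'I_d).
Hypothesis (s0P : (0 < s0.1 < s0.2)%N).

Let J := {s : 'I_d * 'I_d | (0 < s.1 < s.2)%N}.

Definition moment_mpoly (i : 'I_d) : {mpoly C[d]} := 'X_i * \sum_j q i j *: 'X_j.

Lemma moment_mpolyE x i : (moment_mpoly i).@[x] = moment q x i.
Proof.
rewrite mevalM mevalXU rmorph_sum /=; congr (_ * _).
by apply: eq_bigr => j _; rewrite mevalZ mevalXU.
Qed.

Local Notation L := {fraction {mpoly C[d]}}.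
Local Notation F := [tuple moment_mpoly i | i < d].
Local Notation tofrac := (@FracField.tofrac {mpoly C[d]}).

(** The homomorphism [w_i |-> F_i] from polynomials in the weights to rational
    functions on the torus. *)
Definition pullback : {rmorphism {mpoly C[d]} -> L} := (tofrac \o comp_mpoly F).

Lemma comp_momentE (a : {mpoly C[d]}) x : (a \mPo F).@[x] = a.@[moment q x].
Proof.
rewrite comp_mpoly_meval; apply: meval_eq => i.
by rewrite tnth_mktuple moment_mpolyE.
Qed.

Lemma pullback_independent (a : J -> {mpoly C[d]}) :
  \sum_s pullback (a s) * (tofrac 'X_(val s).1 * tofrac 'X_(val s).2) = 0 ->
  forall s, a s = 0.
Proof.
move=> a0; pose b s := if insub s is Some s' then a s' else 0.
suff b0 : forall s : 'I_d * 'I_d, (0 < s.1 < s.2)%N -> b s = 0.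
  by move=> s; have := b0 (val s) (valP s); rewrite /b valK.
apply: (products_independent qC q_diag q_off) => x.
have {}a0 : \sum_s (a s \mPo F) * ('X_(val s).1 * 'X_(val s).2) = 0.
  apply/eqP; rewrite -tofrac_eq0 rmorph_sum -[X in _ == X]a0; apply/eqP.
  by apply: eq_bigr => s _; rewrite !rmorphM.
have := congr1 (meval x) a0; rewrite meval0 rmorph_sum /= => a0x.
rewrite -[RHS]a0x.
rewrite (reindex_onto val (insubd (exist _ s0 s0P : J))) /=; last first.
  by move=> s Ps; rewrite insubdK.
apply: eq_big => [s|s _]; first by rewrite (valP s) valKd eqxx.
by rewrite !mevalM !mevalXU comp_momentE /b valK.
Qed.

Lemma pullback_inj : injective pullback.
Proof.
apply: raddf_inj => a a0.
pose b (s : J) := if val s == s0 then a else 0.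
have : b (exist _ s0 s0P) = 0.
  apply: pullback_independent; apply: big1 => s _.
  by rewrite /b; case: ifP => _; rewrite ?a0 ?rmorph0 mul0r.
by rewrite /b eqxx.
Qed.

Lemma pchar_fraction : [pchar L] =i pred0.
Proof.
apply/pcharf0P => n; rewrite -(rmorph_nat tofrac) tofrac_eq0.
by rewrite -(rmorph_nat (@mpolyC d C)) mpolyC_eq0 pnatr_eq0.
Qed.

Local Notation Phi z G := ((map_poly pullback G).[z]).

Lemma coordinate_algebraic i : algebraicOver (quotient_iota pullback) (tofrac 'X_i).
Proof.
have [G G0 Gx] := algebraic_dependence moment_mpoly 'X_i.
apply: (algebraicOver_iota pullback_inj G0).
by rewrite (map_poly_comp tofrac) horner_map Gx rmorph0.
Qed.

(** The generators [th_o ^+ 2] and [th_i / th_o] are even functions, so a point and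
    its opposite are not counted twice; the normalization [t o = 1] comes from
    [th_o / th_o = 1]. Every equation between them is an element of [A[X]] that
    annihilates the primitive element, and thus survives specialization. One of
    these equations expresses [z] by the generators, which shows that distinct
    roots give distinct points. *)
Lemma generic_solutions : exists2 g : {mpoly C[d]}, g != 0 &
  forall w : 'I_d -> C, g.@[w] != 0 -> (forall i, w i != 0) ->
  exists2 s : seq {ffun 'I_d -> C}, uniq s /\ (#|{: J}| <= size s)%N &
    forall t : {ffun 'I_d -> C}, t \in s -> t o = 1 /\
      exists k, forall i, k * moment q t i = w i.
Proof.
pose th i : L := tofrac 'X_i.
have th0 i : th i != 0.
  rewrite tofrac_eq0; apply/eqP => /(congr1 (meval (fun=> 1))).
  by rewrite mevalXU meval0 => /eqP; rewrite oner_eq0.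
pose x (i : option 'I_d) := if i is Some i then th i / th o else th o ^+ 2.
have xalg i : algebraicOver (quotient_iota pullback) (x i).
  case: i => [i|]; first by apply: algebraic_div; apply: coordinate_algebraic.
  by rewrite /x expr2; apply: algebraic_mul; apply: coordinate_algebraic.
have [n [P [e [r [P0 Pz Pmin e0 rE]]]]] :=
  primitive_presentation pullback_inj pchar_fraction xalg.
set z := \sum_i _ in Pz Pmin rE.
pose rk := r None; pose ro i := r (Some i).
have rkE : Phi z rk = pullback e * th o ^+ 2 by rewrite -rE.
have roE i : Phi z (ro i) = pullback e * (th i / th o) by rewrite -rE.
have PhiM G1 G2 : Phi z (G1 * G2) = Phi z G1 * Phi z G2.
  by rewrite (rmorphM (map_poly pullback)) hornerM.
have PhiC a : Phi z a%:P = pullback a by rewrite (map_polyC pullback) hornerC.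
have PhiB G1 G2 : Phi z (G1 - G2) = Phi z G1 - Phi z G2.
  by rewrite (rmorphB (map_poly pullback)) hornerD hornerN.
have PhiS (T : finType) (G : T -> {poly {mpoly C[d]}}) :
    Phi z (\sum_i G i) = \sum_i Phi z (G i).
  by rewrite (rmorph_sum (map_poly pullback)) horner_sum.
have cardJ : (#|{: J}| <= (size P).-1)%N.
  apply: (independent_card (y := fun s : J => th (val s).1 * th (val s).2)
    (e := fun=> e ^+ 3) (t := fun s => rk * ro (val s).1 * ro (val s).2)
    pullback_inj P0 Pz) => [s|s|a].
  - by rewrite expf_neq0.
  - rewrite PhiM PhiM rkE !roE (rmorphXn pullback).
    exact: product_identity.
  - exact: pullback_independent.
pose G (k : 'I_d + bool) : {poly {mpoly C[d]}} := match k with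
  | inl i => rk * ro i * (\sum_j (q i j)%:MP%:P * ro j) - ('X_i * e ^+ 3)%:P
  | inr true => ro o - e%:P
  | inr false => e%:P * 'X - \sum_i (n i)%:R%:P * r i
  end.
have Gz k : Phi z (G k) = 0.
  case: k => [i|[]] /=.
  - pose S := \sum_j tofrac (q i j)%:MP * th j.
    have pX : pullback 'X_i = th i * S.
      rewrite /= comp_mpolyXU -tnth_nth tnth_mktuple rmorphM rmorph_sum.
      congr (_ * _); apply: eq_bigr => j _.
      by rewrite -mul_mpolyC rmorphM.
    rewrite PhiB PhiM PhiM PhiC (rmorphM pullback) pX (rmorphXn pullback) PhiS rkE roE.
    have -> : \sum_j Phi z ((q i j)%:MP%:P * ro j) = pullback e / th o * S.
      rewrite mulr_sumr; apply: eq_bigr => j _.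
      rewrite PhiM PhiC roE [pullback _%:MP]/= comp_mpolyC.
      exact: coefficient_identity.
    exact: moment_identity.
  - by rewrite PhiB PhiC roE divff // mulr1 subrr.
  - rewrite PhiB PhiM PhiC (map_polyX pullback) hornerX PhiS mulr_sumr -sumrB.
    apply: big1 => i _; rewrite PhiM PhiC (rmorph_nat pullback) -rE.
    exact: multiple_identity.
have [g g0 gP] := specialize_roots pullback_inj pchar_fraction P0 Pz Pmin Gz.
exists (g * e); first by rewrite mulf_neq0.
move=> w; rewrite mevalM mulf_eq0 negb_or => /andP[gw ew] w0.
have [s [us ss] sP] := gP w gw.
pose ev t (H : {poly {mpoly C[d]}}) := (map_poly (meval w) H).[t].
have evM t G1 G2 : ev t (G1 * G2) = ev t G1 * ev t G2.
  by rewrite /ev (rmorphM (map_poly (meval w))) hornerM.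
have evC t a : ev t a%:P = a.@[w] by rewrite /ev (map_polyC (meval w)) hornerC.
have evB t G1 G2 : ev t (G1 - G2) = ev t G1 - ev t G2.
  by rewrite /ev (rmorphB (map_poly (meval w))) hornerD hornerN.
have evS t (T : finType) (H : T -> {poly {mpoly C[d]}}) :
    ev t (\sum_i H i) = \sum_i ev t (H i).
  by rewrite /ev (rmorph_sum (map_poly (meval w))) horner_sum.
pose rho t := [ffun i => ev t (ro i) / e.@[w]].
pose kap t := ev t rk / e.@[w].
have rhoP t : t \in s -> forall i, kap t * moment q (rho t) i = w i.
  move=> ts i; have := sP t ts (inl i); rewrite -/(ev t _) /=.
  rewrite evB !evM evC evS mevalM mevalXU rmorphXn /= => /eqP.
  rewrite subr_eq0 => /eqP E; apply: (mulIf (expf_neq0 3 ew)); rewrite -[RHS]E.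
  have -> : \sum_j ev t ((q i j)%:MP%:P * ro j) = e.@[w] * polar q (rho t) i.
    rewrite /polar mulr_sumr; apply: eq_bigr => j _.
    by rewrite evM evC mevalC ffunE mulrCA [e.@[w] * _]mulrC divfK.
  rewrite /moment /kap ffunE; move: (polar _ _ _) => S.
  by field.
have rho_o t : t \in s -> rho t o = 1.
  move=> ts; have := sP t ts (inr true); rewrite -/(ev t _) /= evB evC => /eqP.
  by rewrite subr_eq0 ffunE => /eqP->; rewrite divff.
have zE t : t \in s -> 
    t = \sum_i (if i is Some j then rho t j else kap t) *+ n i.
  move=> ts; have := sP t ts (inr false); rewrite -/(ev t _) /= evB evM evC evS.
  rewrite {1}/ev (map_polyX (meval w)) hornerX => /eqP.
  rewrite subr_eq0 mulrC => /eqP/(canRL (mulfK ew)) tE; rewrite [LHS]tE.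
  rewrite mulr_suml; apply: eq_bigr => i _.
  rewrite evM evC rmorph_nat -mulrA mulr_natl.
  by case: i => [i|]; rewrite ?ffunE.
exists (map rho s); last first.
  by move=> _ /mapP[t ts ->]; split; [exact: rho_o|exists (kap t); exact: rhoP].
split; last by rewrite size_map ss.
rewrite map_inj_in_uniq // => t1 t2 t1s t2s rho12.
rewrite (zE _ t1s) (zE _ t2s); apply: eq_bigr => -[i|] _; first by rewrite rho12.
congr (_ *+ _).
have := rhoP _ t1s o; rewrite -(rhoP _ t2s o) rho12 => /mulIf; apply.
by apply: contraNneq (w0 o) => m0; rewrite -(rhoP _ t2s o) m0 mulr0.
Qed.

End GenericSolutions.

(** * Critical points on the scaled toric variety *)

Lemma mpoly_ring_ind (C : nzRingType) n (Q : {mpoly C[n]} -> Prop) :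
  (forall c, Q c%:MP) -> (forall i, Q 'X_i) ->
  (forall f g, Q f -> Q g -> Q (f + g)) -> (forall f g, Q f -> Q g -> Q (f * g)) ->
  forall f, Q f.
Proof.
move=> QC QX QD QM; elim/mpolyind => [|c m f _ _ Qf]; first by rewrite -mpolyC0.
apply: QD => //; rewrite -mul_mpolyC; apply: (QM) => //; rewrite mpolyXE_id.
elim/big_ind: _ => [|f1 f2|i _]; [by rewrite -mpolyC1; exact: QC|exact: (QM)|].
elim: (m i) => [|k IHk]; first by rewrite expr0 -mpolyC1.
by rewrite exprS; apply: QM.
Qed.

Section DirectionalDerivative.
Variables (C : numFieldType) (n : nat) (p v : 'rV[C]_n).

(** The functional that defines [cone_tangent]. *)
Definition dir_deriv (f : {mpoly C[n]}) := \sum_(k < n) (f^`M(k)).@[p 0] * v 0 k.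

Lemma dir_derivB f g : dir_deriv (f - g) = dir_deriv f - dir_deriv g.
Proof.
rewrite /dir_deriv -sumrB; apply: eq_bigr => k _.
by rewrite mderivB mevalB mulrBl.
Qed.

Lemma dir_derivZ c f : dir_deriv (c *: f) = c * dir_deriv f.
Proof.
rewrite /dir_deriv mulr_sumr; apply: eq_bigr => k _.
by rewrite mderivZ mevalZ mulrA.
Qed.

Lemma dir_derivM f g :
  dir_deriv (f * g) = dir_deriv f * g.@[p 0] + f.@[p 0] * dir_deriv g.
Proof.
rewrite /dir_deriv mulr_suml mulr_sumr -big_split; apply: eq_bigr => k _ /=.
by rewrite mderivM mevalD !mevalM; ring.
Qed.

Lemma dir_derivX k : dir_deriv 'X_k = v 0 k.
Proof.
rewrite /dir_deriv (bigD1 k) //= big1 ?addr0.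
  have -> : ('X_k)^`M(k) = 1 :> {mpoly C[n]}.
    rewrite mderivX mnm1E eqxx scale1r -mpolyX0; congr 'X_[_].
    by apply/mnmP => i; rewrite mnmBE subnn mnm0E.
  by rewrite meval1 mul1r.
by move=> l lk; rewrite mderivX mnm1E eq_sym (negPf lk) scale0r meval0 mul0r.
Qed.

Definition line_subst : {mpoly C[n]} -> {poly C} :=
  mmap (@polyC C) (fun k => (p 0 k)%:P + v 0 k *: 'X).

Lemma line_substE f s : (line_subst f).[s] = f.@[(p + s *: v) 0].
Proof.
rewrite /line_subst mevalE /mmap horner_sum; apply: eq_bigr => m _.
rewrite hornerCM /mmap1 horner_prod; congr (_ * _); apply: eq_bigr => i _.
by rewrite horner_exp !hornerE !mxE mulrC.
Qed.

Lemma dir_derivE f : (line_subst f)^`().[0] = dir_deriv f.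
Proof.
pose S : {rmorphism {mpoly C[n]} -> {poly C}} :=
  mmap (@polyC C) (fun k => (p 0 k)%:P + v 0 k *: 'X).
have S0 g : (line_subst g).[0] = g.@[p 0].
  by rewrite line_substE scale0r addr0.
elim/mpoly_ring_ind: f => [c|k|f g Hf Hg|f g Hf Hg].
- rewrite /line_subst mmapC derivC horner0 /dir_deriv big1 // => k _.
  by rewrite mderivC meval0 mul0r.
- rewrite dir_derivX /line_subst mmapX mmap1U derivD derivC add0r derivZ derivX.
  by rewrite !hornerE.
- have -> : line_subst (f + g) = line_subst f + line_subst g := rmorphD S f g.
  rewrite derivD hornerD Hf Hg /dir_deriv -big_split; apply: eq_bigr => k _ /=.
  by rewrite mderivD mevalD mulrDl.
- have -> : line_subst (f * g) = line_subst f * line_subst g := rmorphM S f g.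
  by rewrite derivM hornerD !hornerM Hf Hg !S0 dir_derivM.
Qed.

End DirectionalDerivative.

Section FourTermRelations.
Variables (C : numClosedFieldType) (d : nat).
Variables o a b : 'I_d.
Hypotheses (oa : o != a) (ob : o != b) (ab : a != b).
Implicit Types y : 'I_d -> 'I_d -> C.

Let uniq4 (i j k l : 'I_d) : i != j -> i != k -> i != l -> j != k -> j != l ->
  k != l -> uniq [:: i; j; k; l].
Proof. by move=> /= ij ik il jk jl kl; rewrite !inE !negb_or ij ik il jk jl kl. Qed.

(** The relations that hold among logarithms of coordinates [t_i t_j]; they are
    enough to recover the logarithms of the [t_i]. *)
Lemma additive_potential y : (forall i j, i != j -> y i j = y j i) ->
  (forall i j k l, uniq [:: i; j; k; l] -> y i j + y k l = y i k + y j l) ->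
  exists al : 'I_d -> C, forall i j, i != j -> y i j = al i + al j.
Proof.
move=> yC yR; pose s := y o a + y o b - y a b.
have ya k : k != o -> k != a -> y a k = y o k + y o a - s.
  move=> ko ka; have [->|kb] := eqVneq k b; first by rewrite /s; ring.
  have := yR o b k a; rewrite (yC k a) // (yC b a) 1?eq_sym // => E.
  apply: (addrI (y o b)); rewrite E; first by rewrite /s; ring.
  by apply: uniq4; rewrite // eq_sym.
have yE i j : i != o -> j != o -> i != j -> y i j = y o i + y o j - s.
  move=> io jo ij; have [ia|ia] := eqVneq i a.
    by rewrite ia ya // -?ia 1?eq_sym //; ring.
  have [ja|ja] := eqVneq j a; first by rewrite ja yC // ya //; ring.
  apply: (addrI (y o a)); rewrite (yR o a i j) ?ya //; first by ring.
  by apply: uniq4; rewrite // eq_sym.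
(* Twice the value of the potential at o is s. *)
exists (fun i => if i == o then s / 2 else y o i - s / 2) => i j ij.
have [io|io] := eqVneq i o; have [jo|jo] := eqVneq j o.
- by move: ij; rewrite io jo eqxx.
- by rewrite io addrC subrK.
- by rewrite jo yC ?subrK // eq_sym.
- by rewrite yE //; field.
Qed.

Lemma multiplicative_potential y : (forall i j, i != j -> y i j != 0) ->
  (forall i j, i != j -> y i j = y j i) ->
  (forall i j k l, uniq [:: i; j; k; l] -> y i j * y k l = y i k * y j l) ->
  exists2 t : 'I_d -> C, (forall i, t i != 0) &
    forall i j, i != j -> y i j = t i * t j.
Proof.
move=> y0 yC yR; pose s := y o a * y o b / y a b.
have s0 : s != 0 by rewrite !mulf_neq0 ?invr_eq0 ?y0.
have ya k : k != o -> k != a -> y a k = y o k * y o a / s.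
  move=> ko ka; have [->|kb] := eqVneq k b.
    by rewrite /s; field; rewrite !y0.
  have := yR o b k a; rewrite (yC k a) // (yC b a) 1?eq_sym // => E.
  apply: (mulfI (y0 _ _ ob)); rewrite E.
    by rewrite /s; field; rewrite !y0.
  by apply: uniq4; rewrite // eq_sym.
have yE i j : i != o -> j != o -> i != j -> y i j = y o i * y o j / s.
  move=> io jo ij; have [ia|ia] := eqVneq i a.
    by rewrite ia ya // -?ia 1?eq_sym // [y o j * _]mulrC.
  have [ja|ja] := eqVneq j a; first by rewrite ja yC // ya.
  apply: (mulfI (y0 _ _ oa)); rewrite (yR o a i j) ?ya //; first by field.
  by apply: uniq4; rewrite // eq_sym.
have r0 : sqrtC s != 0 by rewrite sqrtC_eq0.
have sE : s = sqrtC s * sqrtC s by rewrite -expr2 sqrtCK.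
(* The square of the potential at o is s. *)
exists (fun i => if i == o then sqrtC s else y o i / sqrtC s) => [i|i j ij].
  by case: (eqVneq i o) => // io; rewrite mulf_neq0 ?invr_eq0 // y0 // eq_sym.
have [io|io] := eqVneq i o; have [jo|jo] := eqVneq j o.
- by move: ij; rewrite io jo eqxx.
- by rewrite io mulrC divfK.
- by rewrite jo yC ?divfK // eq_sym.
- by rewrite yE // {1}sE; field.
Qed.

End FourTermRelations.

Section ToricPoints.
Variables (C : numClosedFieldType) (d : nat) (c : edge d -> C).
Hypothesis d_ge3 : (3 <= d)%N.
Hypothesis c_neq0 : scaling c.
Local Notation n := (n_edges d).
Implicit Types (t : 'I_d -> C) (p v u : 'rV[C]_n) (k : 'I_n).

Definition edge_coef (s : 'I_d * 'I_d) : C := if insub s is Some e then c e else 0.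

(** The matrix of twice the quadratic form [\sum_(i < j) c_ij t_i t_j]. *)
Definition sym_coef (i j : 'I_d) : C := edge_coef (i, j) + edge_coef (j, i).

Lemma edge_coef0 (i j : 'I_d) : (j <= i)%N -> edge_coef (i, j) = 0.
Proof. by move=> ji; rewrite /edge_coef insubF //= ltnNge ji. Qed.

Lemma edge_coefE k : edge_coef (edge_of k) = c (enum_val k).
Proof. by rewrite /edge_coef /edge_of valK. Qed.

Lemma insub_edge (i j : 'I_d) (ij : (i < j)%N) :
  insub (i, j) = Some (exist _ (i, j) ij : edge d).
Proof. exact: (insubT (fun s : 'I_d * 'I_d => (s.1 < s.2)%N) (x := (i, j)) ij). Qed.

Lemma sym_coefC i j : sym_coef i j = sym_coef j i.
Proof. exact: addrC. Qed.

Lemma sym_coef_diag i : sym_coef i i = 0.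
Proof. by rewrite /sym_coef !edge_coef0 ?addr0. Qed.

Lemma sym_coef_off i j : i != j -> sym_coef i j != 0.
Proof.
rewrite -val_eqE /sym_coef /= neq_ltn => /orP[ij|ij].
  rewrite (edge_coef0 (ltnW ij)) addr0 /edge_coef.
  by rewrite (insub_edge ij).
rewrite (edge_coef0 (ltnW ij)) add0r /edge_coef.
by rewrite (insub_edge ij).
Qed.

Lemma edge_lt k : ((edge_of k).1 < (edge_of k).2)%N.
Proof. exact: (valP (enum_val k)). Qed.

Lemma edge_neq k : (edge_of k).1 != (edge_of k).2.
Proof. by rewrite -val_eqE /= ltn_eqF ?edge_lt. Qed.

Lemma edge_of_inj : injective (@edge_of d).
Proof. by move=> k l /val_inj /enum_val_inj. Qed.

(** A name for the coordinate attached to an unordered pair. *)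
Lemma edge_index : exists ix : 'I_d -> 'I_d -> 'I_n, forall i j, i != j ->
  (edge_of (ix i j) = (i, j) \/ edge_of (ix i j) = (j, i)) /\ ix i j = ix j i.
Proof.
have k0 : 'I_n by rewrite n_edgesE; apply: (@Ordinal _ 0); rewrite bin_gt0; lia.
pose ix (i j : 'I_d) : 'I_n :=
  if (insub (i, j) : option (edge d)) is Some e then enum_rank e
  else if (insub (j, i) : option (edge d)) is Some e then enum_rank e else k0.
exists ix => i j; rewrite -val_eqE /= neq_ltn.
have main (a b : 'I_d) : (a < b)%N -> edge_of (ix a b) = (a, b) /\ ix a b = ix b a.
  move=> ab; rewrite /ix (insub_edge ab).
  by rewrite [insub (b, a)]insubF ?/edge_of ?enum_rankK //= ltnNge ltnW.
by case/orP => [/main[H1 H2]|/main[H1 H2]]; split; rewrite ?H2; [left| |right|];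
  rewrite ?H2 -?H2.
Qed.

Definition incidence i k : bool := ((edge_of k).1 == i) || ((edge_of k).2 == i).

(** The sufficient statistics of [u]. *)
Definition vertex_weight u i : C := \sum_k u 0 k *+ incidence i k.

Definition toric_point t : 'rV[C]_n :=
  \row_k (c (enum_val k) * t (edge_of k).1 * t (edge_of k).2).

Lemma sum_incidence (a : 'I_d -> C) k :
  \sum_i a i *+ incidence i k = a (edge_of k).1 + a (edge_of k).2.
Proof.
rewrite (bigD1 (edge_of k).1) //= (bigD1 (edge_of k).2) /=; last by rewrite eq_sym edge_neq.
rewrite /incidence !eqxx orbT big1 ?addr0 // => i /andP[/negPf i1 /negPf i2].
by rewrite eq_sym i1 eq_sym i2.
Qed.

Lemma vertex_weight_sum u (a : 'I_d -> C) :
  \sum_i a i * vertex_weight u i = \sum_k u 0 k * (a (edge_of k).1 + a (edge_of k).2).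
Proof.
under eq_bigr do rewrite mulr_sumr.
rewrite exchange_big; apply: eq_bigr => k _ /=.
rewrite -sum_incidence mulr_sumr; apply: eq_bigr => i _.
by rewrite mulrnAr mulrC -mulrnAr.
Qed.

Lemma sum_edges (h : 'I_d * 'I_d -> C) :
  \sum_k c (enum_val k) * h (edge_of k) = \sum_s edge_coef s * h s.
Proof.
rewrite [RHS](bigID (fun s : 'I_d * 'I_d => (s.1 < s.2)%N)) /= [X in _ + X]big1 ?addr0.
  have [ix ixP] := edge_index.
  rewrite (reindex_onto (@edge_of d) (fun s => ix s.1 s.2)) /=.
    apply: eq_big => [k|k _]; last by rewrite edge_coefE.
    rewrite edge_lt /=; apply/esym/eqP; apply: edge_of_inj.
    have [[E|H] _] := ixP _ _ (edge_neq k); first by rewrite E -surjective_pairing.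
    by have := edge_lt (ix (edge_of k).1 (edge_of k).2); rewrite H /= ltnNge ltnW ?edge_lt.
  move=> [i j] /= ij; have nij : i != j by rewrite -val_eqE /= ltn_eqF.
  have [[-> //|H] _] := ixP i j nij.
  by have := edge_lt (ix i j); rewrite H /= ltnNge ltnW.
by move=> [i j] /=; rewrite -leqNgt => /edge_coef0->; rewrite mul0r.
Qed.

(** Both sides are [t_i] times the derivative of the quadratic form along [t_i]. *)
Lemma vertex_weight_toric t i :
  vertex_weight (toric_point t) i = moment sym_coef t i.
Proof.
transitivity (\sum_k c (enum_val k) * ((t (edge_of k).1 * t (edge_of k).2) *+
    (((edge_of k).1 == i) + ((edge_of k).2 == i)))).
  apply: eq_bigr => k _; rewrite mxE -mulrA -[LHS]mulrnAr; congr (_ * (_ *+ _)).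
  rewrite /incidence; case: eqP => [<-|_] //=.
  by rewrite eq_sym (negPf (edge_neq k)).
rewrite (sum_edges (fun s => (t s.1 * t s.2) *+ ((s.1 == i) + (s.2 == i)))).
rewrite /moment /polar /sym_coef mulr_sumr.
under [RHS]eq_bigr do rewrite mulrDl mulrDr.
under [LHS]eq_bigr do rewrite mulrnDr mulrDr.
rewrite !big_split /=; congr (_ + _).
  rewrite (bigID (fun s : 'I_d * 'I_d => s.1 == i)) /= [X in _ + X]big1 ?addr0.
    rewrite (reindex_onto (pair i) snd) /=; last by case=> a b /= /eqP->.
    apply: eq_big => [j|j _]; first by rewrite !eqxx.
    by rewrite eqxx mulr1n; ring.
  by move=> s /negPf->; rewrite mulr0n mulr0.
rewrite (bigID (fun s : 'I_d * 'I_d => s.2 == i)) /= [X in _ + X]big1 ?addr0.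
  rewrite (reindex_onto (fun j => (j, i)) fst) /=; last by case=> a b /= /eqP->.
  apply: eq_big => [j|j _]; first by rewrite !eqxx.
  by rewrite eqxx mulr1n; ring.
by move=> s /negPf->; rewrite mulr0n mulr0.
Qed.

Let ix := sval (cid edge_index).
Let ixP (i j : 'I_d) : i != j ->
  (edge_of (ix i j) = (i, j) \/ edge_of (ix i j) = (j, i)) /\ ix i j = ix j i.
Proof. exact: (svalP (cid edge_index)). Qed.

Lemma ix_edge k : ix (edge_of k).1 (edge_of k).2 = k.
Proof.
apply: edge_of_inj; have [[->|H] _] := ixP (edge_neq k).
  by rewrite -surjective_pairing.
by have := edge_lt (ix (edge_of k).1 (edge_of k).2); rewrite H /= ltnNge ltnW ?edge_lt.
Qed.

Lemma toric_pointE t k :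
  toric_point t 0 k = sym_coef (edge_of k).1 (edge_of k).2 *
    (t (edge_of k).1 * t (edge_of k).2).
Proof.
rewrite mxE mulrA /sym_coef -surjective_pairing edge_coefE.
by rewrite (@edge_coef0 (edge_of k).2) ?addr0 // ltnW ?edge_lt.
Qed.

Lemma toric_point_ix t i j : i != j ->
  toric_point t 0 (ix i j) = sym_coef i j * (t i * t j).
Proof.
move=> /ixP[[H|H] _]; rewrite toric_pointE H //=.
by rewrite sym_coefC [t j * _]mulrC.
Qed.

Lemma toric_point_neq0 t : (forall i, t i != 0) -> forall k, toric_point t 0 k != 0.
Proof. by move=> t0 k; rewrite mxE !mulf_neq0. Qed.

(** Relations [p_ij p_kl ~ p_ik p_jl] of the second hypersimplex. *)
Definition binomial (i j k l : 'I_d) : {mpoly C[n]} :=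
  (sym_coef i k * sym_coef j l) *: ('X_(ix i j) * 'X_(ix k l)) -
  (sym_coef i j * sym_coef k l) *: ('X_(ix i k) * 'X_(ix j l)).

Lemma uniq4P (i j k l : 'I_d) : uniq [:: i; j; k; l] ->
  [/\ i != j, k != l, i != k & j != l].
Proof. by rewrite /= !inE !negb_or => /and4P[/and3P[-> -> _] /andP[_ ->] -> _]. Qed.

Lemma binomial_vanishing (i j k l : 'I_d) : uniq [:: i; j; k; l] ->
  homog_vanishing (torus_image c) (binomial i j k l).
Proof.
move=> /uniq4P[ij kl ik jl]; split.
  have XX k1 k2 : ('X_k1 * 'X_k2 : {mpoly C[n]}) \is 2.-homog.
    by rewrite (_ : 2%N = 1 + 1)%N //; apply: dhomogM; rewrite dhomogX /= mdeg1.
  by exists 2%N; apply: rpredB; apply: dhomogZ.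
move=> _ [t _ ->]; rewrite -/(toric_point t) mevalB !mevalZ !mevalM !mevalXU.
by rewrite !toric_point_ix //; ring.
Qed.

Lemma toric_in_closure t : (forall i, t i != 0) -> scaled_toric c (toric_point t).
Proof.
move=> t0; split; last by move=> f [_]; apply; exists t.
have o : 'I_d := Ordinal (ltn_trans (isT : 0 < 2)%N d_ge3).
(* Any coordinate would do. *)
apply/eqP => /rowP/(_ (ix o o)); rewrite [RHS]mxE; apply/eqP.
exact: toric_point_neq0.
Qed.

(** The four-term binomials cut out the torus orbit off the coordinate
    hyperplanes. *)
Lemma closure_toric p : scaled_toric c p -> (forall k, p 0 k != 0) ->
  exists2 t, (forall i, t i != 0) & p = toric_point t.
Proof.
move=> [_ pV] p0.
pose o : 'I_d := Ordinal (ltn_trans (isT : 0 < 2)%N d_ge3).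
pose a : 'I_d := Ordinal (ltn_trans (isT : 1 < 2)%N d_ge3).
pose b : 'I_d := Ordinal d_ge3.
pose y i j := p 0 (ix i j) / sym_coef i j.
have [] := @multiplicative_potential C d o a b isT isT isT y.
- by move=> i j ij; rewrite mulf_neq0 // invr_eq0 sym_coef_off.
- by move=> i j ij; rewrite /y sym_coefC (ixP ij).2.
- move=> i j k l u; have [ij kl ik jl] := uniq4P u.
  have := pV _ (binomial_vanishing u).
  rewrite mevalB !mevalZ !mevalM !mevalXU => /eqP; rewrite subr_eq0 => /eqP E.
  have Q0 := sym_coef_off.
  have D : sym_coef i k * sym_coef j l * (sym_coef i j * sym_coef k l) != 0.
    by rewrite !mulf_neq0 ?Q0.
  apply: (mulfI D); rewrite /y.
  have -> : sym_coef i k * sym_coef j l * (sym_coef i j * sym_coef k l) *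
     (p 0 (ix i j) / sym_coef i j * (p 0 (ix k l) / sym_coef k l)) =
     sym_coef i k * sym_coef j l * (p 0 (ix i j) * p 0 (ix k l)).
    by field; rewrite !Q0.
  by rewrite E; field; rewrite !Q0.
move=> t t0 yE; exists t => //; apply/rowP => k.
rewrite toric_pointE -yE ?edge_neq // /y ix_edge mulrC divfK //.
by rewrite sym_coef_off ?edge_neq.
Qed.

(** The linearized binomials are additive four-term relations between the
    logarithmic derivatives [v_k / p_k]. *)
Lemma toric_tangent t v : (forall i, t i != 0) ->
  cone_tangent (scaled_toric c) (toric_point t) v ->
  exists al : 'I_d -> C, forall k,
    v 0 k = toric_point t 0 k * (al (edge_of k).1 + al (edge_of k).2).
Proof.
move=> t0 vT; pose p := toric_point t; have p0 := toric_point_neq0 t0.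
pose o : 'I_d := Ordinal (ltn_trans (isT : 0 < 2)%N d_ge3).
pose a : 'I_d := Ordinal (ltn_trans (isT : 1 < 2)%N d_ge3).
pose b : 'I_d := Ordinal d_ge3.
pose y i j := v 0 (ix i j) / p 0 (ix i j).
have vE i j : v 0 (ix i j) = p 0 (ix i j) * y i j by rewrite mulrC divfK.
have [] := @additive_potential C d o a b isT isT isT y.
- by move=> i j ij; rewrite /y (ixP ij).2.
- move=> i j k l u; have [ij kl ik jl] := uniq4P u.
  have bV : homog_vanishing (scaled_toric c) (binomial i j k l).
    have [h bV] := binomial_vanishing u; split=> // x [_]; apply.
    exact: binomial_vanishing.
  have := vT _ bV; rewrite -/(dir_deriv _ _ _) dir_derivB !dir_derivZ !dir_derivM.
  rewrite !dir_derivX !mevalXU !vE /p !toric_point_ix //.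
  set m := sym_coef i j * sym_coef k l * sym_coef i k * sym_coef j l *
    (t i * t j * t k * t l).
  have m0 : m != 0 by rewrite !mulf_neq0 ?sym_coef_off.
  move=> E; apply: (mulfI m0); apply/eqP; rewrite -subr_eq0 -E; apply/eqP.
  by rewrite /m; ring.
move=> al yE; exists al => k.
by rewrite -{1}(ix_edge k) vE yE ?edge_neq // ix_edge.
Qed.

(** An edge meets the vertex [i] at most once, so replacing [t_i] by
    [t_i * (1 + s)] moves the toric point along a straight line in [s]; a
    polynomial that vanishes on the variety vanishes on this line. *)
Lemma incidence_tangent t i : (forall i, t i != 0) ->
  cone_tangent (scaled_toric c) (toric_point t)
    (\row_k (toric_point t 0 k *+ incidence i k)).
Proof.
move=> t0 f fV; set v := \row_k _; rewrite -/(dir_deriv (toric_point t) v f) -dir_derivE.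
have f0 : line_subst (toric_point t) v f * ('X + 1) = 0.
  apply: poly_eq0_infinite => s; rewrite hornerM !hornerE line_substE.
  have [->|s1] := eqVneq s (- 1); first by rewrite addNr mulr0.
  have -> : toric_point t + s *: v = toric_point
      (fun j => t j *+ (j != i) + (t j * (1 + s)) *+ (j == i)).
    apply/rowP => k; rewrite !mxE /incidence.
    have [e1|e1] := eqVneq (edge_of k).1 i; have [e2|e2] := eqVneq (edge_of k).2 i.
    + by have := edge_neq k; rewrite e1 e2 eqxx.
    + by rewrite /= ?mulr1n ?mulr0n; ring.
    + by rewrite /= ?mulr1n ?mulr0n; ring.
    + by rewrite /= ?mulr1n ?mulr0n; ring.
  rewrite (fV.2 (toric_point _)) ?mul0r //; apply: toric_in_closure => j.
  case: (eqVneq j i) => _; rewrite ?mulr1n ?mulr0n ?addr0 ?add0r // mulf_neq0 //.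
  by rewrite addrC -[1]opprK subr_eq0.
have /eqP := f0; rewrite mulf_eq0 => /orP[/eqP->|]; first by rewrite derivC horner0.
by move/eqP/(congr1 (horner_eval 0)); rewrite /horner_eval !hornerE => /eqP; rewrite oner_eq0.
Qed.

Lemma vertex_weight_total u : \sum_i vertex_weight u i = 2 * \sum_k u 0 k.
Proof.
have := vertex_weight_sum u (fun=> 1); rewrite mulr_sumr => H.
transitivity (\sum_i 1 * vertex_weight u i).
  by apply: eq_bigr => i _; rewrite mul1r.
by rewrite H; apply: eq_bigr => k _; rewrite mulrC.
Qed.

(** Along the tangent vector [p_ij (al_i + al_j)] the differential of the
    logarithm of the likelihood is the pairing of [al] with the difference of
    [vertex_weight u] and a multiple of [moment sym_coef t]. *)
Lemma critical_toric_point t u ka : (forall i, t i != 0) ->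
  \sum_k u 0 k != 0 ->
  (forall i, ka * moment sym_coef t i = vertex_weight u i) ->
  critical (scaled_toric c) u (toric_point t).
Proof.
move=> t0 u0 tE; have p0 := toric_point_neq0 t0.
have uE : \sum_k u 0 k = ka * \sum_k toric_point t 0 k.
  apply: (mulfI (_ : 2 != 0)); first by rewrite pnatr_eq0.
  rewrite mulrCA -!vertex_weight_total mulr_sumr; apply: eq_bigr => i _.
  by rewrite vertex_weight_toric tE.
have S0 : \sum_k toric_point t 0 k != 0.
  by apply: contraNneq u0 => S0; rewrite uE S0 mulr0.
split; first exact: toric_in_closure.
  move=> /eqP; rewrite mulf_eq0 (negPf S0) orbF => /prodf_eq0[k _].
  by rewrite (negPf (p0 k)).
move=> v /(toric_tangent t0)[al vE]; rewrite /dlog_likelihood.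
have -> : \sum_k u 0 k * v 0 k / toric_point t 0 k = \sum_i al i * vertex_weight u i.
  rewrite vertex_weight_sum; apply: eq_bigr => k _.
  by rewrite vE; field.
have -> : \sum_k v 0 k = \sum_i al i * moment sym_coef t i.
  under [RHS]eq_bigr do rewrite -vertex_weight_toric.
  by rewrite vertex_weight_sum; apply: eq_bigr.
have -> : \sum_i al i * vertex_weight u i = ka * \sum_i al i * moment sym_coef t i.
  by rewrite mulr_sumr; apply: eq_bigr => i _; rewrite -tE mulrCA.
by rewrite uE; field.
Qed.

(** The tangent vector of [incidence_tangent] at [i] gives the equation at the
    vertex [i]. *)
Lemma critical_moment p u : critical (scaled_toric c) u p ->
  exists2 t : 'I_d -> C, (forall i, t i != 0) & p = toric_point t /\
    exists ka, forall i, ka * moment sym_coef t i = vertex_weight u i.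
Proof.
move=> [pV pH pT]; have {pH} [p0 S0] : (forall k, p 0 k != 0) /\ \sum_k p 0 k != 0.
  split=> [k|]; apply/eqP => p0; apply: pH; rewrite /hyperplanes /=.
    by rewrite (bigD1 k) //= p0 !mul0r.
  by rewrite p0 mulr0.
have [t t0 pE] := closure_toric pV p0; exists t => //; split=> //.
exists ((\sum_k u 0 k) / \sum_k p 0 k) => i.
rewrite pE in pT p0 S0 *; have := pT _ (incidence_tangent i t0).
rewrite /dlog_likelihood => /eqP; rewrite subr_eq0 => /eqP H.
rewrite -vertex_weight_toric mulrAC /vertex_weight.
transitivity ((\sum_k u 0 k) * (\sum_k (\row_k0 (toric_point t 0 k0 *+ incidence i k0)) 0 k) /
  \sum_k toric_point t 0 k).
  by congr (_ * _ / _); apply: eq_bigr => k _; rewrite [RHS]mxE.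
rewrite -H; apply: eq_bigr => k _.
by rewrite [X in _ * X / _]mxE -[RHS](mulfK (p0 k)) mulrnAl mulrnAr.
Qed.

End ToricPoints.

(** * Squared distances: quadrics tangent to a conic *)

Section TangentLines.
Variables (C : numClosedFieldType) (d : nat) (x w : 'I_d -> C).
Hypothesis d_ge2 : (2 <= d)%N.
Hypothesis x_inj : injective x.
Implicit Types t : 'I_d -> C.

Definition sqr_dist (i j : 'I_d) : C := (x i - x j) ^+ 2.

Definition node_poly : {poly C} := \prod_i ('X - (x i)%:P).
Definition node_poly_but i : {poly C} := \prod_(j | j != i) ('X - (x j)%:P).
(** The rational function [num_poly / den_poly] maps [s] to
    [s - W * P(s) / N(s)] ([num_polyE]), so it fixes the nodes. *)
Definition den_poly : {poly C} := \sum_i w i *: node_poly_but i.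
Definition num_poly : {poly C} := \sum_i (w i * x i) *: node_poly_but i.

Local Notation P := node_poly.
Local Notation N := den_poly.
Local Notation A := num_poly.
Local Notation W := (\sum_i w i).

Hypothesis w_neq0 : forall i, w i != 0.
Hypothesis W_neq0 : W != 0.
(* The function num_poly / den_poly maps infinity to the weighted mean of the
   nodes, so this excludes cycles through infinity. *)
Hypothesis mean_neq0 : N.[(\sum_i w i * x i) / W] != 0.

Lemma node_polyE i s : P.[s] = (s - x i) * (node_poly_but i).[s].
Proof. by rewrite /P (bigD1 i) //= hornerM !hornerE. Qed.

Lemma node_poly_but_node i j : i != j -> (node_poly_but i).[x j] = 0.
Proof.
by move=> ij; rewrite /node_poly_but (bigD1 j) 1?eq_sym //= hornerM !hornerE subrr mul0r.
Qed.

Lemma num_polyE s : A.[s] = s * N.[s] - W * P.[s].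
Proof.
rewrite !horner_sum mulr_sumr mulr_suml -sumrB; apply: eq_bigr => i _.
by rewrite !hornerZ (node_polyE i); ring.
Qed.

Lemma num_poly_node i : A.[x i] = x i * N.[x i].
Proof. by rewrite num_polyE (node_polyE i) subrr mul0r mulr0 subr0. Qed.

Lemma den_poly_node i : N.[x i] != 0.
Proof.
rewrite horner_sum (bigD1 i) //= big1 ?addr0.
  rewrite hornerZ mulf_neq0 // horner_prod; apply/prodf_neq0 => j ji.
  by rewrite !hornerE subr_eq0 (inj_eq x_inj) eq_sym.
by move=> j ji; rewrite hornerZ node_poly_but_node // mulr0.
Qed.

Lemma node_poly_but_size i : size (node_poly_but i) = d.
Proof.
rewrite /node_poly_but -big_filter size_prod_XsubC size_filter -sum1_count sum1_card.
by rewrite (cardC1 i) card_ord prednK // (leq_trans _ d_ge2).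
Qed.

Lemma node_poly_but_coef i : (node_poly_but i)`_d.-1 = 1.
Proof.
have /monicP := monic_prod_XsubC [seq j <- index_enum _ | j != i] xpredT x.
by rewrite lead_coefE big_filter -/(node_poly_but i) node_poly_but_size.
Qed.

Lemma comb_size (a : 'I_d -> C) : (size (\sum_i a i *: node_poly_but i)%R <= d)%N.
Proof.
apply: leq_trans (size_sum _ _ _) _; apply/bigmax_leqP => i _.
by rewrite (leq_trans (size_scale_leq _ _)) // node_poly_but_size.
Qed.

Lemma comb_coef (a : 'I_d -> C) : (\sum_i a i *: node_poly_but i)`_d.-1 = \sum_i a i.
Proof.
rewrite coef_sum; apply: eq_bigr => i _.
by rewrite coefZ node_poly_but_coef mulr1.
Qed.

(** For [r = A(s) / N(s)] this is [N(s) ^+ d.-1 * (A(r) - s * N(r))], the numerator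
    of the fixed point equation of the second iterate of [A / N]. *)
Definition cycle_poly : {poly C} :=
  \sum_(k < d) A`_k *: (A ^+ k * N ^+ (d.-1 - k)) -
  'X * \sum_(k < d) N`_k *: (A ^+ k * N ^+ (d.-1 - k)).

Lemma cycle_poly_size : (size cycle_poly <= (d.-1 ^ 2).+2)%N.
Proof.
have pow_size (p : {poly C}) k : (size p <= d)%N -> (size (p ^+ k)%R <= (d.-1 * k).+1)%N.
  move=> pd; have := size_poly_exp_leq p k => /leq_trans; apply.
  by rewrite ltnS leq_mul2r; apply/orP; right; lia.
have comb (p : {poly C}) : (size (\sum_(k < d) p`_k *: (A ^+ k * N ^+ (d.-1 - k)))%R
    <= (d.-1 ^ 2).+1)%N.
  apply: leq_trans (size_sum _ _ _) _; apply/bigmax_leqP => k _.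
  apply: leq_trans (size_scale_leq _ _) _; apply: leq_trans (size_polyMleq _ _) _.
  have := pow_size A k (comb_size _); have := pow_size N (d.-1 - k)%N (comb_size _).
  have kd : (k <= d.-1)%N by have := ltn_ord k; lia.
  have : (d.-1 ^ 2 = d.-1 * k + d.-1 * (d.-1 - k))%N by rewrite -mulnDr subnKC.
  move: (size (A ^+ k)) (size (N ^+ _)) => u v; lia.
apply: leq_trans (size_polyD _ _) _; rewrite size_polyN geq_max.
rewrite (leq_trans (comb _)) //=; apply: leq_trans (size_polyMleq _ _) _.
by rewrite size_polyX; apply: comb.
Qed.

Lemma cycle_poly_root s r :
  N.[s] != 0 -> A.[s] = r * N.[s] -> A.[r] = s * N.[r] -> cycle_poly.[s] = 0.
Proof.
move=> Ns As Ar.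
have comb (p : {poly C}) : (size p <= d)%N ->
    (\sum_(k < d) p`_k *: (A ^+ k * N ^+ (d.-1 - k))).[s] = N.[s] ^+ d.-1 * p.[r].
  move=> pd; rewrite horner_sum (horner_coef_wide _ pd) mulr_sumr.
  apply: eq_bigr => k _; rewrite hornerZ hornerM !horner_exp As exprMn.
  have kd : (k <= d.-1)%N by have := ltn_ord k; lia.
  by rewrite -{2}(subnKC kd) exprD; ring.
rewrite /cycle_poly !hornerE !comb ?comb_size // Ar; ring.
Qed.

(** At a root of [N] only the terms with [k = d.-1] survive. Such a point goes to
    infinity and then to the weighted mean, which is not a root of [N]. *)
Lemma cycle_poly_neq0 : cycle_poly != 0.
Proof.
have Nsize : size N = d.
  apply/eqP; rewrite eqn_leq comb_size /= leqNgt; apply/negP => Nd.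
  case/eqP: W_neq0; rewrite -[LHS]comb_coef -/N nth_default // -ltnS prednK //.
  exact: ltnW.
have [nu /rootP Nnu] : exists nu, root N nu.
  by apply/closed_rootP; rewrite Nsize; lia.
have Pnu : P.[nu] != 0.
  rewrite horner_prod; apply/prodf_neq0 => i _; rewrite !hornerE subr_eq0.
  by apply: contraTneq (den_poly_node i) => <-; rewrite Nnu eqxx.
have Anu : A.[nu] != 0.
  by rewrite num_polyE Nnu mulr0 sub0r oppr_eq0 mulf_neq0.
have comb (p : {poly C}) :
    (\sum_(k < d) p`_k *: (A ^+ k * N ^+ (d.-1 - k))).[nu] = p`_d.-1 * A.[nu] ^+ d.-1.
  have dd : (d.-1 < d)%N by lia.
  rewrite horner_sum (bigD1 (Ordinal dd)) //= big1 ?addr0.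
    by rewrite subnn expr0 mulr1 hornerZ horner_exp.
  move=> k kd; rewrite hornerZ hornerM !horner_exp Nnu expr0n.
  have -> : ((d.-1 - k)%N == 0%N) = false.
    by have := ltn_ord k; move: kd; rewrite -val_eqE /=; lia.
  by rewrite mulr0 mulr0.
apply/eqP => /(congr1 (fun p => p.[nu])).
rewrite horner0 /cycle_poly !hornerE !comb !comb_coef mulrA -mulrBl => /eqP.
rewrite mulf_eq0 expf_eq0 (negPf Anu) andbF orbF subr_eq0 => /eqP mu.
by move: mean_neq0; rewrite mu mulfK // Nnu eqxx.
Qed.

Definition cycle s r := [/\ N.[s] != 0, A.[s] = r * N.[s] & A.[r] = s * N.[r]].

Lemma polar_sqr_dist t i : polar sqr_dist t i =
  (\sum_j t j) * x i ^+ 2 - 2 * (\sum_j t j * x j) * x i + \sum_j t j * x j ^+ 2.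
Proof.
rewrite /polar /sqr_dist !mulr_suml mulr_sumr mulr_suml -sumrB -big_split /=.
by apply: eq_bigr => j _; ring.
Qed.

(** With [f y = \sum_j (y - x_j) ^+ 2 * t_j] one has [w_i = ka * t_i * f(x_i)]. Its
    discriminant is nonzero because it is proportional to [W], and its leading
    coefficient [\sum_j t_j] is nonzero because otherwise the single root of [f]
    would be the weighted mean and a root of [N]. Substituting
    [f = a * (y - s) * (y - r)] into [N] and [A] gives
    [N(s) = - ka * a * P(s) * \sum_i t_i * (x_i - r)] and
    [A(s) = - ka * a * P(s) * \sum_i t_i * x_i * (x_i - r)], hence
    [A(s) = r * N(s)]. *)
Lemma solution_cycle t ka : (forall i, ka * moment sqr_dist t i = w i) ->
  exists s r la, [/\ s != r, cycle s r, cycle r s &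
    forall i, t i = la * (w i / ((x i - s) * (x i - r)))].
Proof.
move=> tE; set a := \sum_j t j; set b := \sum_j t j * x j.
set e := \sum_j t j * x j ^+ 2.
have fE i : ka * (t i * (a * x i ^+ 2 - 2 * b * x i + e)) = w i.
  by rewrite -tE /moment polar_sqr_dist.
have lin f al be ga : (forall i, f i = t i * (al * x i ^+ 2 + be * x i + ga)) ->
    \sum_i f i = al * e + be * b + ga * a.
  move=> fi; rewrite !mulr_sumr -!big_split /=; apply: eq_bigr => i _.
  by rewrite fi; ring.
have WE : W = ka * (2 * (a * e - b ^+ 2)).
  rewrite (lin _ (ka * a) (- ka * (2 * b)) (ka * e)); first by ring.
  by move=> i; rewrite -fE; ring.
have ka0 : ka != 0 by apply: contraNneq W_neq0 => ka0; rewrite WE ka0 mul0r.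
have a0 : a != 0.
  apply: contraNneq mean_neq0 => a0.
  have b0 : b != 0.
    by apply: contraNneq W_neq0 => b0; rewrite WE a0 b0; apply/eqP; ring.
  pose r := e / (2 * b); have eE : e = 2 * b * r by rewrite /r; field.
  have -> : (\sum_i w i * x i) / W = r.
    rewrite (lin _ (- ka * (2 * b)) (ka * e) 0); last first.
      by move=> i; rewrite -fE a0; ring.
    by rewrite WE /r a0; field; rewrite b0 ka0.
  apply/eqP; transitivity (2 * b * ka * P.[r] * a); last by rewrite a0 mulr0.
  rewrite horner_sum mulr_sumr; apply: eq_bigr => i _.
  by rewrite hornerZ -fE a0 eE (node_polyE i); ring.
have D0' : b ^+ 2 - a * e != 0.
  by apply: contraNneq W_neq0 => D0; rewrite WE -opprB D0 oppr0 !mulr0.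
pose D := sqrtC (b ^+ 2 - a * e).
have DE : D ^+ 2 = b ^+ 2 - a * e by rewrite sqrtCK.
have D0 : D != 0 by rewrite sqrtC_eq0.
have eE : e = (b ^+ 2 - D ^+ 2) / a by rewrite DE; field.
have fac E (y : C) : E ^+ 2 = D ^+ 2 ->
    a * y ^+ 2 - 2 * b * y + e = a * (y - (b + E) / a) * (y - (b - E) / a).
  by move=> ED; rewrite eE -ED; field.
(* E = D and E = - D give the cycle in its two orders. *)
have half E : E ^+ 2 = D ^+ 2 -> E != 0 -> cycle ((b + E) / a) ((b - E) / a).
  move=> ED E0; set s := (b + E) / a; set r := (b - E) / a.
  have wE i : w i = ka * a * (t i * ((x i - s) * (x i - r))).
    by rewrite -fE (fac E) // -/s -/r; ring.
  have NE : forall s' r', (s' = s /\ r' = r) \/ (s' = r /\ r' = s) ->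
      N.[s'] = - ka * a * P.[s'] * (b - a * r').
    move=> s' r' H.
    transitivity (- ka * a * P.[s'] * \sum_i t i * (x i - r')); last first.
      congr (_ * _); rewrite (lin _ 0 1 (- r')); first by ring.
      by move=> i; ring.
    rewrite horner_sum mulr_sumr; apply: eq_bigr => i _.
    rewrite hornerZ wE (node_polyE i).
    by case: H => -[-> ->]; ring.
  have AE : forall s' r', (s' = s /\ r' = r) \/ (s' = r /\ r' = s) ->
      A.[s'] = - ka * a * P.[s'] * (e - b * r').
    move=> s' r' H.
    transitivity (- ka * a * P.[s'] * \sum_i t i * (x i * (x i - r'))); last first.
      congr (_ * _); rewrite (lin _ 1 (- r') 0); first by ring.
      by move=> i; ring.
    rewrite horner_sum mulr_sumr; apply: eq_bigr => i _.
    rewrite hornerZ wE (node_polyE i).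
    by case: H => -[-> ->]; ring.
  have Hs : (s = s /\ r = r) \/ (s = r /\ r = s) by left.
  have Hr : (r = s /\ s = r) \/ (r = r /\ s = s) by right.
  have Ps0 : P.[s] != 0.
    rewrite horner_prod; apply/prodf_neq0 => i _; rewrite !hornerE.
    apply: contraNneq (w_neq0 i) => /eqP; rewrite subr_eq0 => /eqP sx.
    by rewrite wE sx; apply/eqP; ring.
  have bE : b - a * r = E by rewrite /r; field.
  split; first by rewrite (NE s r Hs) bE !mulf_neq0 ?oppr_eq0.
    by rewrite (NE s r Hs) (AE s r Hs) eE -ED /r; field.
  by rewrite (NE r s Hr) (AE r s Hr) eE -ED /s; field.
exists ((b + D) / a), ((b - D) / a), (ka * a)^-1; split.
- rewrite -subr_eq0 (_ : _ - _ = 2 * D / a); last by field.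
  by rewrite !mulf_neq0 ?invr_eq0 ?pnatr_eq0.
- exact: half.
- have := half (- D); rewrite opprK sqrrN oppr_eq0; apply => //.
- move=> i; rewrite -fE (fac D) //.
  set s := (b + D) / a; set r := (b - D) / a.
  have : (x i - s) * (x i - r) != 0.
    apply: contraNneq (w_neq0 i) => H; rewrite -fE (fac D) // -/s -/r -mulrA H.
    by rewrite !mulr0.
  rewrite mulf_eq0 negb_or => /andP[xs xr].
  by field; rewrite ka0 a0 xs xr.
Qed.

(** The points of a cycle determine each other and the solution up to scaling, so
    the cycles of non-proportional solutions are disjoint from each other and from
    the nodes. All these points are roots of [cycle_poly], which gives
    [d + 2 * m <= d.-1 ^ 2 + 1]. *)
Lemma solutions_bound m (t : 'I_m -> 'I_d -> C) (ka : 'I_m -> C) :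
  (forall k i, ka k * moment sqr_dist (t k) i = w i) ->
  (forall k l, (exists la, forall i, t k i = la * t l i) -> k = l) ->
  (m <= 'C(d.-1, 2))%N.
Proof.
move=> tE t_inj.
have H k : exists srl : C * C * C, [/\ srl.1.1 != srl.1.2, cycle srl.1.1 srl.1.2,
    cycle srl.1.2 srl.1.1 & forall i, t k i =
      srl.2 * (w i / ((x i - srl.1.1) * (x i - srl.1.2)))].
  by have [s [r [la [? ? ? ?]]]] := solution_cycle (tE k); exists (s, r, la).
have [srl srlP] := fin_all_exists H.
(* The nodes, and the two points of each cycle. *)
pose pt (z : 'I_d + 'I_m * bool) : C := match z with
  | inl i => x i
  | inr (k, c) => if c then (srl k).1.1 else (srl k).1.2
  end.
have la0 k : (srl k).2 != 0.
  pose i0 : 'I_d := Ordinal (ltnW d_ge2).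
  have [_ _ _ tk] := srlP k; apply: contraNneq (w_neq0 i0) => l0.
  by rewrite -(tE k) /moment tk l0 !mul0r mulr0.
have node_cycle i : cycle (x i) (x i).
  by split; [exact: den_poly_node | exact: num_poly_node | exact: num_poly_node].
have pt_neq k c : pt (inr (k, c)) != pt (inr (k, ~~ c)).
  by have [? _ _ _] := srlP k; case: c; rewrite // eq_sym.
have cyc_node k c : cycle (pt (inr (k, c))) (pt (inr (k, ~~ c))).
  by case: c; have [_ ? ? _] := srlP k.
have cyc_fun s r r' : cycle s r -> cycle s r' -> r = r'.
  by move=> [Ns As _] [_ Ar _]; apply: (mulIf Ns); rewrite -As -Ar.
have node_neq i k c : x i <> pt (inr (k, c)).
  move=> E; have := cyc_node k c; rewrite -E => /(cyc_fun _ _ _ (node_cycle i)) E'.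
  by have := pt_neq k c; rewrite -E E' eqxx.
have pt_inj : injective pt.
  move=> [i|[k c]] [j|[l e]].
  - by move/x_inj->.
  - by move/node_neq.
  - by move/esym/node_neq.
  move=> E; have E' : pt (inr (k, ~~ c)) = pt (inr (l, ~~ e)).
    by apply: (cyc_fun (pt (inr (k, c)))); rewrite // E.
  have tkl : k = l.
    apply: t_inj; exists ((srl k).2 / (srl l).2) => i.
    have [_ _ _ ->] := srlP k; have [_ _ _ ->] := srlP l.
    have -> : (x i - (srl k).1.1) * (x i - (srl k).1.2) =
        (x i - (srl l).1.1) * (x i - (srl l).1.2).
      by move: E E'; rewrite /pt; case: (c); case: (e) => /= -> ->; rewrite // mulrC.
    by rewrite [RHS]mulrA divfK.
  subst l; congr (inr (_, _)); apply/eqP; apply: contraT => ce.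
  have ec : e = ~~ c by case: (c) (e) ce => -[].
  by have := pt_neq k c; rewrite E ec eqxx.
have rs_root : all (root (cycle_poly)) (map pt (enum {: 'I_d + 'I_m * bool})).
  apply/allP => _ /mapP[[i|[k c]] _ ->]; apply/rootP.
    by have [? ? ?] := node_cycle i; apply: (@cycle_poly_root _ (x i)).
  by have [? ? ?] := cyc_node k c; apply: (@cycle_poly_root _ (pt (inr (k, ~~ c)))).
have := max_poly_roots cycle_poly_neq0 rs_root.
rewrite (map_inj_uniq pt_inj) enum_uniq size_map -cardE => /(_ isT).
rewrite card_sum card_prod !card_ord card_bool => lt_m.
have {lt_m} := leq_trans lt_m cycle_poly_size; rewrite ltnS bin2 geq_half_double.
by case: (d) d_ge2 => [|[|n]] //= _; rewrite -mul2n; nia.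
Qed.

End TangentLines.

(** * Counting the critical points *)

Local Open Scope classical_set_scope.

Lemma card_le_uniq (T : choiceType) (A : set T) (s : seq T) :
  uniq s -> (forall x, x \in s -> A x) -> (`I_(size s) #<= A)%card.
Proof.
case: s => [|x0 s] us sA; first by rewrite II0 card_ge0.
have nth_inj : {in `I_(size (x0 :: s)) &, injective (nth x0 (x0 :: s))}.
  move=> i j; rewrite !inE => si sj /eqP; rewrite nth_uniq //; exact/eqP.
have := inj_card_eq nth_inj; rewrite card_eq_sym => /card_eqPle[+ _].
move=> /card_le_trans; apply; apply: subset_card_le => _ [i si <-].
by apply: sA; apply: mem_nth.
Qed.

Lemma card_eq_uniq (T : choiceType) (A : set T) (s : seq T) :
  uniq s -> (forall x, A x <-> x \in s) -> (A #= `I_(size s))%card.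
Proof.
case: s => [|x0 s] us sA.
  have -> : A = set0 by apply/seteqP; split=> // x /sA.
  by rewrite II0 card_eq00.
have nth_inj : {in `I_(size (x0 :: s)) &, injective (nth x0 (x0 :: s))}.
  move=> i j; rewrite !inE => si sj /eqP; rewrite nth_uniq //; exact/eqP.
suff {1}-> : A = nth x0 (x0 :: s) @` `I_(size (x0 :: s)) by exact: inj_card_eq.
apply/seteqP; split=> [x /sA /(nthP x0)[i si <-]|_ [i si <-]]; first by exists i.
by apply/sA/mem_nth.
Qed.

Section GenericWeights.
Variables (C : numClosedFieldType) (d : nat).
Hypothesis d_ge3 : (3 <= d)%N.
Local Notation n := (n_edges d).

Let o : 'I_d := Ordinal (ltn_trans (isT : 0 < 2)%N d_ge3).
Let s0 : 'I_d * 'I_d := (Ordinal (ltn_trans (isT : 1 < 2)%N d_ge3), Ordinal d_ge3).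

(** Shift the edges of the complete graph on [d.-1] vertices by one. *)
Lemma card_pairs :
  ('C(d.-1, 2) <= #|{: {s : 'I_d * 'I_d | 0 < s.1 < s.2}}|)%N.
Proof.
have [d' dE] : exists d', d = d'.+1 by exists d.-1; lia.
subst d; rewrite /= -n_edgesE /n_edges.
pose f (e : edge d') : {s : 'I_d'.+1 * 'I_d'.+1 | (0 < s.1 < s.2)%N} :=
  exist (fun s : 'I_d'.+1 * 'I_d'.+1 => (0 < s.1 < s.2)%N)
    (lift ord0 (val e).1, lift ord0 (val e).2) (valP e).
apply: (@leq_card _ _ f) => e1 e2 /(congr1 val) [E1 E2]; apply: val_inj.
rewrite [LHS]surjective_pairing [RHS]surjective_pairing.
by congr (_, _); apply: val_inj.
Qed.

Definition weight_mpoly (i : 'I_d) : {mpoly C[n]} := \sum_k 'X_k *+ incidence i k.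

Definition weight_pullback (g : {mpoly C[d]}) : {mpoly C[n]} :=
  g \mPo [tuple weight_mpoly i | i < d].

Lemma weight_pullbackE g (u : 'rV[C]_n) :
  (weight_pullback g).@[u 0] = g.@[vertex_weight u].
Proof.
rewrite comp_mpoly_meval; apply: meval_eq => i.
rewrite tnth_mktuple rmorph_sum /=; apply: eq_bigr => k _.
by rewrite mevalMn mevalXU.
Qed.

(** The weights of toric points are the values of the moment map, and these are
    not contained in a hypersurface. *)
Lemma weight_pullback_neq0 g : g != 0 -> weight_pullback g != 0.
Proof.
apply: contra_neq => g0; pose c (e : edge d) : C := 1.
have c0 : scaling c by move=> e; rewrite oner_eq0.
apply: (pullback_inj (sym_coefC c) (sym_coef_diag c) (sym_coef_off c0)
  (isT : (0 < s0.1 < s0.2)%N)).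
rewrite rmorph0 /=; apply/eqP; rewrite tofrac_eq0; apply/eqP.
apply: mpoly_eq0_meval => t; rewrite comp_momentE.
have := congr1 (meval ((toric_point c t) 0)) g0.
rewrite weight_pullbackE meval0 => <-; apply: meval_eq => i.
by rewrite vertex_weight_toric.
Qed.

Lemma coordinates_prod_neq0 m : \prod_(i < m) 'X_i != 0 :> {mpoly C[m]}.
Proof.
apply/prodf_neq0 => i _; apply/eqP => /(congr1 (meval (fun=> 1))).
by rewrite mevalXU meval0 => /eqP; rewrite oner_eq0.
Qed.

Lemma coordinates_sum_neq0 : \sum_(i < d) 'X_i != 0 :> {mpoly C[d]}.
Proof.
apply/eqP => /(congr1 (meval (fun=> 1))); rewrite meval0 rmorph_sum /=.
under eq_bigr do rewrite mevalXU; rewrite sumr_const card_ord => /eqP.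
by rewrite pnatr_eq0; case: (d) d_ge3.
Qed.

Lemma sum_weights_neq0 (u : 'rV[C]_n) :
  \sum_i vertex_weight u i != 0 -> \sum_k u 0 k != 0.
Proof. by apply: contra_neq => u0; rewrite vertex_weight_total u0 mulr0. Qed.

Section ScaledToric.
Variable c : edge d -> C.
Hypothesis c_neq0 : scaling c.

(** If [t1_i t1_j = la * t2_i t2_j] for [i != j], then the pairs with [o] give
    [t1_i = la * t2_i], and a pair without [o] gives [la = la ^ 2]. *)
Lemma toric_lines_inj (t1 t2 : {ffun 'I_d -> C}) : t1 o = 1 -> t2 o = 1 ->
  (forall i, t1 i != 0) -> (forall i, t2 i != 0) ->
  (<[toric_point c t1]> = <[toric_point c t2]>)%VS -> t1 = t2.
Proof.
move=> t1o t2o t1_neq0 t2_neq0 E.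
have /vlineP[la laE] : toric_point c t1 \in <[toric_point c t2]>%VS.
  by rewrite -E memv_line.
have prodE i j : i != j -> t1 i * t1 j = la * (t2 i * t2 j).
  move=> ij; have [ix ixP] := edge_index d_ge3.
  have := congr1 (fun p : 'rV_n => p 0 (ix i j)) laE; rewrite [RHS]mxE.
  rewrite !toric_pointE; have [[->|->] _] := ixP i j ij => /=;
    rewrite [RHS]mulrCA => /mulfI; rewrite sym_coef_off // 1?eq_sym // => /(_ isT) //.
  by rewrite mulrC => ->; rewrite [t2 j * _]mulrC.
have t1E i : i != o -> t1 i = la * t2 i.
  by move=> io; have := prodE i o io; rewrite t1o t2o !mulr1.
have la1 : la = 1.
  have := prodE s0.1 s0.2 isT; rewrite !t1E // mulrACA.
  have m0 : t2 s0.1 * t2 s0.2 != 0 by rewrite mulf_neq0.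
  move/(mulIf m0); have la0 : la != 0.
    apply: contraNneq (t1_neq0 s0.1) => la0.
    by rewrite t1E // la0 mul0r.
  by rewrite -[RHS]mulr1 => /(mulfI la0).
apply/ffunP => i; have [->|io] := eqVneq i o; first by rewrite t1o t2o.
by rewrite t1E // la1 mul1r.
Qed.

Lemma many_critical_points : exists2 g : {mpoly C[n]}, g != 0 &
  forall u : 'rV[C]_n, g.@[u 0] != 0 ->
  exists2 s : seq {vspace 'rV[C]_n}, uniq s /\ ('C(d.-1, 2) <= size s)%N &
    forall l, l \in s -> critical_points (scaled_toric c) u l.
Proof.
have [g g0 gP] := generic_solutions (sym_coefC c) (sym_coef_diag c)
  (sym_coef_off c_neq0) o (isT : (0 < s0.1 < s0.2)%N).
exists (weight_pullback (g * \prod_i 'X_i * \sum_i 'X_i)).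
  apply: weight_pullback_neq0.
  by rewrite !mulf_neq0 ?coordinates_prod_neq0 ?coordinates_sum_neq0.
move=> u; rewrite weight_pullbackE !mevalM !mulf_eq0 !negb_or.
move=> /andP[/andP[/gP gu]]; rewrite !rmorph_prod rmorph_sum /=.
move=> /prodf_neq0 w0 W0.
have {}w0 i : vertex_weight u i != 0 by have := w0 i isT; rewrite mevalXU.
have u0 : \sum_k u 0 k != 0.
  apply: sum_weights_neq0; move: W0.
  by under eq_bigr do rewrite mevalXU.
have [s [us ss] sP] := gu w0.
have t0 t : t \in s -> forall i, t i != 0.
  move=> /sP[_ [k kE]] i; apply: contraNneq (w0 i) => ti.
  by rewrite -kE /moment ti mul0r mulr0.
exists [seq <[toric_point c (t : {ffun 'I_d -> C})]>%VS | t <- s].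
  rewrite size_map map_inj_in_uniq; last first.
    move=> t1 t2 s1 s2; apply: toric_lines_inj; try exact: t0.
      by have [] := sP _ s1.
    by have [] := sP _ s2.
  by split=> //; apply: leq_trans card_pairs ss.
move=> _ /mapP[t ts ->]; have [_ [k kE]] := sP _ ts.
exists (toric_point c t) => //.
by apply: (@critical_toric_point _ _ _ d_ge3 c_neq0 _ _ k) => //; exact: t0.
Qed.

End ScaledToric.

Definition node (i : 'I_d) : C := (i : nat)%:R.

Lemma node_inj : injective node.
Proof. by move=> i j /eqP; rewrite eqr_nat => /eqP /val_inj. Qed.

Definition sqr_dist_scaling (e : edge d) : C := sqr_dist node (val e).1 (val e).2.

Lemma sqr_dist_scaling_neq0 : scaling sqr_dist_scaling.
Proof.
move=> e; rewrite expf_neq0 // subr_eq0 (inj_eq node_inj) -val_eqE /=.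
by rewrite ltn_eqF // (valP e).
Qed.

Lemma moment_sqr_dist t i :
  moment (sym_coef sqr_dist_scaling) t i = moment (sqr_dist node) t i.
Proof.
congr (_ * _); apply: eq_bigr => j _; congr (_ * _).
have [->|] := eqVneq i j; first by rewrite sym_coef_diag /sqr_dist subrr expr0n.
rewrite -val_eqE /= neq_ltn /sym_coef => /orP[ij|ij].
  by rewrite (edge_coef0 _ (ltnW ij)) addr0 /edge_coef (insub_edge ij).
rewrite (edge_coef0 _ (ltnW ij)) add0r /edge_coef (insub_edge ij).
by rewrite /sqr_dist_scaling /sqr_dist /= -sqrrN opprB.
Qed.

(** [W ^+ d.-1] times the value of [den_poly] at the weighted mean, as a
    polynomial in the weights. *)
Definition mean_mpoly : {mpoly C[d]} :=
  \sum_i 'X_i * \prod_(j | j != i) (\sum_k node k *: 'X_k - node j *: \sum_k 'X_k).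

(** All the weight is put on the node [o], whose mean is the node itself. *)
Lemma mean_mpoly_neq0 : mean_mpoly != 0.
Proof.
pose e (i : 'I_d) : C := (i == o)%:R.
have sum_e (a : 'I_d -> C) : \sum_k a k * e k = a o.
  rewrite (bigD1 o) //= big1 ?addr0 /e ?eqxx ?mulr1 // => k /negPf->.
  by rewrite mulr0.
apply/eqP => /(congr1 (meval e)).
rewrite meval0 rmorph_sum /=.
under eq_bigr do rewrite mevalM mevalXU mulrC.
rewrite sum_e rmorph_prod /= => /eqP; apply/negP.
apply/prodf_neq0 => j jo; rewrite mevalB mevalZ !rmorph_sum /=.
under eq_bigr do rewrite mevalZ mevalXU.
under [X in _ * X]eq_bigr do rewrite mevalXU -[e _]mul1r.
by rewrite !sum_e mulr1 subr_eq0 (inj_eq node_inj) eq_sym.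
Qed.

Lemma mean_mpolyE w : \sum_i w i != 0 -> mean_mpoly.@[w] != 0 ->
  (den_poly node w).[(\sum_i w i * node i) / \sum_i w i] != 0.
Proof.
move=> W0; apply: contra_neq => N0; set W := \sum_i w i in W0 N0 *.
rewrite -[RHS](mulr0 (W ^+ d.-1)) -[X in _ * X]N0 horner_sum mulr_sumr rmorph_sum.
apply: eq_bigr => i _; rewrite /= mevalM mevalXU rmorph_prod hornerZ mulrCA.
congr (_ * _); rewrite horner_prod.
have -> : d.-1 = #|[pred j : 'I_d | j != i]| by rewrite (cardC1 i) card_ord.
rewrite -prodr_const -big_split /=; apply: eq_bigr => j _.
rewrite mevalB mevalZ !rmorph_sum !hornerE mulrBr [W * (_ / W)]mulrC divfK //.
congr (_ - _); last first.
  by rewrite mulrC; congr (_ * _); apply: eq_bigr => k _; rewrite /= mevalXU.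
by apply: eq_bigr => k _; rewrite /= mevalZ mevalXU mulrC.
Qed.

Lemma few_critical_points : exists2 g : {mpoly C[n]}, g != 0 &
  forall u : 'rV[C]_n, g.@[u 0] != 0 ->
  forall s : seq {vspace 'rV[C]_n}, uniq s ->
    (forall l, l \in s -> critical_points (scaled_toric sqr_dist_scaling) u l) ->
    (size s <= 'C(d.-1, 2))%N.
Proof.
exists (weight_pullback (mean_mpoly * \prod_i 'X_i * \sum_i 'X_i)).
  apply: weight_pullback_neq0.
  by rewrite !mulf_neq0 ?coordinates_prod_neq0 ?coordinates_sum_neq0 ?mean_mpoly_neq0.
move=> u; rewrite weight_pullbackE !mevalM !mulf_eq0 !negb_or.
move=> /andP[/andP[M0]]; rewrite !rmorph_prod rmorph_sum /=.
move=> /prodf_neq0 w0 W0 s us sP.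
have {}w0 i : vertex_weight u i != 0 by have := w0 i isT; rewrite mevalXU.
have {}W0 : \sum_i vertex_weight u i != 0.
  by move: W0; under eq_bigr do rewrite mevalXU.
have pick (k : 'I_(size s)) : exists tk : {ffun 'I_d -> C} * C,
    (forall i, tk.1 i != 0) /\ nth 0%VS s k = <[toric_point sqr_dist_scaling tk.1]>%VS /\
    forall i, tk.2 * moment (sqr_dist node) tk.1 i = vertex_weight u i.
  have [p /(critical_moment d_ge3 sqr_dist_scaling_neq0)[t t0 [pE [ka kaE]]] pl] :=
    sP _ (mem_nth 0%VS (ltn_ord k)).
  have tE i : [ffun i => t i] i = t i by rewrite ffunE.
  exists ([ffun i => t i], ka); split=> [i|]; first by rewrite tE.
  have -> : ([ffun i => t i] : 'I_d -> C) = t by apply: funext.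
  by split=> [|i]; [rewrite -pl pE | rewrite -moment_sqr_dist].
have [tk tkP] := fin_all_exists pick.
apply: (@solutions_bound _ _ node (vertex_weight u) _ node_inj w0 W0 _ _
  (fun k => (tk k).1) (fun k => (tk k).2)).
- exact: ltnW.
- exact: mean_mpolyE.
- by move=> k i; have [_ [_ ]] := tkP k.
move=> k l [la laE]; apply: val_inj; apply/eqP.
rewrite -(nth_uniq 0%VS (ltn_ord k) (ltn_ord l) us).
have [tk0 [-> _]] := tkP k; have [tl0 [-> _]] := tkP l.
have la0 : la != 0.
  by apply: contraNneq (tk0 o) => la0; rewrite laE la0 mul0r.
have -> : toric_point sqr_dist_scaling (tk k).1 =
    la ^+ 2 *: toric_point sqr_dist_scaling (tk l).1.
  by apply/rowP => i; rewrite !mxE !laE; ring.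
apply/eqP/vspaceP => v; apply/vlineP/vlineP => -[b ->].
  by exists (b * la ^+ 2); rewrite scalerA.
by exists (b / la ^+ 2); rewrite scalerA divfK // expf_neq0.
Qed.

(** For squared distances the two generic bounds meet; for any scaling whose ML
    degree is defined, a common generic point of data exhibits at least
    ['C(d.-1, 2)] critical points. *)
Lemma minimum_ML_degree : is_min_ML_degree C d 'C(d.-1, 2).
Proof.
split.
  exists sqr_dist_scaling; first exact: sqr_dist_scaling_neq0.
  have [g1 g10 g1P] := many_critical_points sqr_dist_scaling_neq0.
  have [g2 g20 g2P] := few_critical_points.
  exists (g1 * g2); first by rewrite mulf_neq0.
  move=> u; rewrite mevalM mulf_eq0 negb_or => /andP[/g1P[s [us ss] sP] /g2P few].
  have sE : size s = 'C(d.-1, 2) by apply/eqP; rewrite eqn_leq ss few.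
  rewrite -sE; apply: card_eq_uniq => // l; split; last exact: sP.
  move=> lA; apply: contraT => ls; have := few (l :: s).
  rewrite /= ls us sE ltnn => /(_ isT); apply=> l'.
  by rewrite inE => /orP[/eqP->|/sP].
move=> m [c c0 [g g0 gP]].
have [g1 g10 g1P] := many_critical_points c0.
have [u gu] : exists u : 'rV[C]_n, (g * g1).@[u 0] != 0.
  apply: contrapT => H; have : g * g1 != 0 by rewrite mulf_neq0.
  case/eqP; apply: mpoly_eq0_meval => w; apply/eqP/negPn/negP => ww; apply: H.
  exists (\row_k w k); apply: contraNneq ww => <-.
  by apply/eqP/meval_eq => k; rewrite mxE.
move: gu; rewrite mevalM mulf_eq0 negb_or => /andP[/gP cardA /g1P[s [us ss] sP]].
apply: leq_trans ss _; rewrite -card_le_II.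
by rewrite -(card_le_eqr cardA); apply: card_le_uniq.
Qed.

End GenericWeights.

Local Close Scope classical_set_scope.
Local Close Scope ring_scope.

Theorem theorem1p6 (R : realType) (d : nat) (hd3 : 3 <= d) (hd6 : d <= 6) :
  is_min_ML_degree (complex R) d 'C(d.-1, 2).
Proof. exact: minimum_ML_degree. Qed.
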